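(* Let $S_1,\dots,S_m\in\mathbf{AdS}$ be admissible subsets and let $y_1,\dots,y_m$ be real numbers. Suppose that $P\subset\mathbb{R}^n$ is a type B generalized permutohedron with $P=y_1\Delta^0_{S_1}+\cdots+y_m\Delta^0_{S_m}$ (signed Minkowski sum). Then the volume of $P$ is given by $$\mathrm{Vol}(P)=\sum_{T\in\mathbf{AdS}_n}\left(\sum_{\mathbf{a}\in\mathrm{D}(P_T)}\frac{y_1^{a_1}}{a_1!}\cdots\frac{y_m^{a_m}}{a_m!}\right).$$
   Context: Let $n,m\ge1$, $[n]=\{1,\dots,n\}$, $[\bar n]=\{\bar1,\dots,\bar n\}$, $[n,\bar n]=[n]\sqcup[\bar n]$. Let $\mathbf{e}_1,\dots,\mathbf{e}_n$ be the standard basis of $\mathbb{R}^n$ and $\mathbf{e}_{\bar i}:=-\mathbf{e}_i$ for $i\in[n]$. Admissible subsets: $\mathbf{AdS}$ is the set of nonempty $S\subset[n,\bar n]$ such that $\{i,\bar i\}\not\subset S$ for all $i\in[n]$; $\mathbf{AdS}_n:=\{S\in\mathbf{AdS}: |S|=n\}$. For $S\in\mathbf{AdS}$, $\Delta^0_S:=\mathrm{conv}(\{\mathbf 0\}\cup\{\mathbf{e}_i: i\in S\})$. A type B generalized permutohedron in $\mathbb{R}^n$ is a polytope each of whose edges is parallel to $\mathbf{e}_i+\mathbf{e}_j$, $\mathbf{e}_i-\mathbf{e}_j$ or $\mathbf{e}_i$ for some $i,j\in[n]$. The expression $P=y_1\Delta^0_{S_1}+\cdots+y_m\Delta^0_{S_m}$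 with coefficients of arbitrary sign means that $P$ is a (nonempty) polytope satisfying the Minkowski-sum identity $$P+\sum_{i:\,y_i<0}(-y_i)\Delta^0_{S_i}=\sum_{i:\,y_i\ge0}y_i\Delta^0_{S_i}$$ (an empty Minkowski sum being $\{\mathbf 0\}$). For $T\in\mathbf{AdS}_n$, $\mathrm{D}(P_T)$ (the set of $G$-draconian sequences of $P_T$, which depends only on the sets $S_i\cap T$) is the set of sequences $\mathbf a=(a_1,\dots,a_m)$ of nonnegative integers with $a_1+\cdots+a_m=n$ and $\sum_{i\in I}a_i\le\big|\bigcup_{i\in I}(S_i\cap T)\big|$ for every nonempty $I\subseteq[m]$. $\mathrm{Vol}(P)$ denotes the volume of $P$ with respect to the lattice $\mathbb{Z}^n\cap\mathrm{aff}(P)$ in the affine span $\mathrm{aff}(P)$ of $P$. The convention $0^0=1$ is used.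
   Formalization: Vol(P) is taken as the n-dimensional Lebesgue volume in R^n (0 if P is not full-dimensional) instead of the volume relative to the lattice in aff(P), for which the formula fails, e.g. for n=2, P=[0,e_1]; both agree when P is full-dimensional. *)

(* Defs.v *)
From mathcomp Require Import all_boot all_order all_algebra.

Set Implicit Arguments.
Unset Strict Implicit.
Unset Printing Implicit Defensive.

Import Order.TTheory GRing.Theory Num.Theory.

(* [n, nbar]: the element i is inl i and ibar is inr i. *)
Notation pm_index n := ('I_n + 'I_n)%type.

Definition AdS (n : nat) : {set {set pm_index n}} :=
  [set S | (S != set0) && [forall i : 'I_n, ~~ ([set inl i; inr i] \subset S)]].

Definition AdS_max (n : nat) : {set {set pm_index n}} :=
  [set S in AdS n | #|S| == n].

Definition is_draconian (n m : nat) (S : 'I_m -> {set pm_index n})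
    (T : {set pm_index n}) (a : 'I_m -> nat) : bool :=
  (\sum_(i < m) a i == n) &&
  [forall I : {set 'I_m}, (I != set0) ==>
    (\sum_(i in I) a i <= #|\bigcup_(i in I) (S i :&: T)|)].

Lemma is_draconian_le (n m : nat) (S : 'I_m -> {set pm_index n})
    (T : {set pm_index n}) (a : 'I_m -> nat) (i : 'I_m) :
  is_draconian S T a -> a i <= n.
Proof. by case/andP=> /eqP sum_a _; rewrite -[leqRHS]sum_a (bigD1 i) //= leq_addr. Qed.

(* By is_draconian_le the terms of a draconian sequence are at most n, so that
   restricting them to 'I_n.+1 loses no sequence and makes the set finite. *)
Definition draconian (n m : nat) (S : 'I_m -> {set pm_index n})
    (T : {set pm_index n}) : {set {ffun 'I_m -> 'I_n.+1}} :=
  [set a : {ffun 'I_m -> 'I_n.+1} | is_draconian S T (fun i => a i)].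

From mathcomp Require Import all_classical all_reals all_analysis.

Local Open Scope classical_set_scope.
Local Open Scope ring_scope.

Section Polytopes.
Variables (R : realType) (n : nat).
Local Notation V := 'rV[R]_n.
Implicit Types (A B P : set V) (u v w c x : V).

Definition dot u v : R := \sum_(i < n) u 0 i * v 0 i.

Definition conv_hull A : set V := smallest (@convex_set R V) A.

Definition is_polytope P : Prop :=
  exists A, [/\ finite_set A, A !=set0 & P = conv_hull A].

Definition face P c : set V :=
  [set x | P x /\ forall z, P z -> dot c z <= dot c x].

(* The segment [u, v] is a one-dimensional face of P. *)
Definition is_edge P u v : Prop :=
  u <> v /\ exists c, face P c = conv_hull [set u; v].

Definition basis_vec (k : pm_index n) : V :=
  match k with
  | inl i => delta_mx 0 i
  | inr i => - delta_mx 0 i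
  end.

Definition typeB_direction w : Prop :=
  exists i j : 'I_n,
    [\/ w = basis_vec (inl i) + basis_vec (inl j),
        w = basis_vec (inl i) - basis_vec (inl j)
      | w = basis_vec (inl i)].

(* Since v - u <> 0 for an edge, the direction e_i - e_i = 0 is never used. *)
Definition typeB_gen_permutohedron P : Prop :=
  is_polytope P /\
  forall u v, is_edge P u v ->
    exists w (t : R), typeB_direction w /\ v - u = t *: w.

Definition simplex0 (S : {set pm_index n}) : set V :=
  conv_hull (0 |` [set basis_vec k | k in [set` S]]).

Definition mink_add A B : set V := [set a + b | a in A & b in B].

Definition dilate (t : R) A : set V := [set t *: a | a in A].

Definition is_signed_mink_sum (m : nat) P (y : 'I_m -> R)
    (S : 'I_m -> {set pm_index n}) : Prop :=
  mink_add P
    (\big[mink_add/[set 0]]_(i < m | y i < 0) dilate (- y i) (simplex0 (S i)))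
  = \big[mink_add/[set 0]]_(i < m | 0 <= y i) dilate (y i) (simplex0 (S i)).

End Polytopes.

(* The n-fold product of the Lebesgue measure of R, computed by slicing as in
   product_measure1: the n-dimensional volume in R^n, for which a fundamental
   cell of Z^n has volume 1. It is 0 on a polytope that is not
   full-dimensional. *)
Fixpoint vol (R : realType) (n : nat) : set 'rV[R]_n -> \bar R :=
  match n return set 'rV[R]_n -> \bar R with
  | 0%N => fun A => (\1_A 0)%:E
  | k.+1 => fun A =>
      (\int[@lebesgue_measure R]_t
         vol [set x : 'rV[R]_k | A (row_mx t%:M x : 'rV[R]_k.+1)])%E
  end.

(* Main.v *)
Require Import Defs.
From mathcomp Require Import all_boot all_order all_algebra.
From mathcomp Require Import fingroup perm ring lra.

Set Implicit Arguments.
Unset Strict Implicit.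
Unset Printing Implicit Defensive.
Import Order.TTheory GRing.Theory Num.Theory.

(** Write [r_S(A)] for the indicator that [S] meets the signed set [A], and put
    [f = \sum_i y_i r_(S i)].  Since [r_S] is the support function of the simplex
    of [S] at the vector of [A], the Minkowski identity forces the support
    function of [P] to be [f] on the vectors of signed sets.  Every linear form
    is a nonnegative combination of vectors of a chain of signed sets, on which
    all support functions involved are additive ([layer_cake]); with separation
    this gives [P = {x | <A, x> <= f A for all A}] ([signed_sum_polytope]), and
    subadditivity of the support function of [P] makes [f] bisubmodular.  It remains
    to compute the volume of such a polytope for any bisubmodular [f] that vanishes
    at the empty set.

    The candidate is a polynomial in [f].  For one orthant it is the polarised
    form [mixed]: the form on functions of subsets whose value at
    [r_(S 1), ..., r_(S n)] is 1 or 0 according to Hall's condition for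
    [S 1, ..., S n], extended multilinearly by Möbius inversion; [hall_vol f] is
    its diagonal value divided by [n!].  Expanding [f] in the [r_(S i)] and
    collecting equal factors gives the draconian sum of an orthant
    ([hall_vol_draconian]).

    That the volume is the sum of the [hall_vol] over all orthants is proved by
    induction on the dimension ([vol_bisubmodular]).  The slice of the polytope
    at [x_0 = t] is again of this kind, for the function
    [min (f A, f (A, +) - t, f (A, -) + t)], so the claim is that the candidate
    satisfies the same integral recursion; by the fundamental theorem of calculus
    this is a statement about derivatives.  The key is that [mixed] vanishes as
    soon as two of its arguments are supported on mutually incomparable sets
    ([mixed_incomparable]): this follows from an exchange property of Hall's
    condition ([hall_exchange]).  Because of it the two truncations in the slice
    do not interact ([hall_vol_incomparable]), and when the cut [x_0 <= t] moves,
    the derivative of the candidate only sees the face [x_0 = t]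
    ([mixed_truncation], [is_derive_truncation]).  Comparing the primitive at both
    ends of the range of [x_0] yields exactly the two orthants over each orthant
    of the slice ([primitive_sub]). *)

(** * The Hall condition *)

Section HallCondition.
Variables (J X : finType).
Implicit Types (S : J -> {set X}) (I : {set J}).

Definition hall S : bool := [forall I : {set J}, #|I| <= #|\bigcup_(i in I) S i|].

Lemma eq_hall S S' : S =1 S' -> hall S = hall S'.
Proof.
move=> eqS; apply: eq_forallb => I.
by rewrite (eq_bigr S') // => i _; apply: eqS.
Qed.

Lemma hall_violator S :
  ~~ hall S -> exists I, #|\bigcup_(i in I) S i| < #|I|.
Proof. by rewrite negb_forall => /existsP[I]; rewrite -ltnNge; exists I. Qed.

Lemma hall_mono S S' : (forall i, S i \subset S' i) -> hall S -> hall S'.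
Proof.
move=> sub /forallP hS; apply/forallP => I; apply: leq_trans (hS I) _.
apply/subset_leq_card/bigcupsP => i iI.
exact: subset_trans (sub i) (bigcup_sup i iI).
Qed.

Lemma hall_neq0 S i : hall S -> S i != set0.
Proof.
move=> /forallP /(_ [set i]); rewrite cards1 big_set1 card_gt0. exact.
Qed.

Lemma hall_inj S (s : J -> J) : injective s -> hall S -> hall (S \o s).
Proof.
move=> s_inj /forallP hS; apply/forallP => I; rewrite -(card_imset _ s_inj).
apply: leq_trans (hS _) (subset_leq_card _); apply/bigcupsP => _ /imsetP[k kI ->].
exact: (bigcup_sup k kI (F := S \o s)).
Qed.

Definition add_elt (i : J) (x : X) S : J -> {set X} :=
  fun k => if k == i then x |: S k else S k.

Lemma sub_add_elt i x S k : S k \subset add_elt i x S k.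
Proof. by rewrite /add_elt; case: ifP => _ //; apply: subsetUr. Qed.

(** The element [x] is already reserved for [j], so it is of no use to [i]. *)
Lemma hall_add_singleton i j x S :
  j != i -> S j = [set x] -> hall (add_elt i x S) = hall S.
Proof.
move=> ji Sj; apply/idP/idP; last by apply: hall_mono (sub_add_elt _ _ _).
move=> /forallP hS; apply/forallP => I.
have sub (K : {set J}) : K \subset j |: I ->
    \bigcup_(k in K) add_elt i x S k \subset x |: \bigcup_(k in I) S k.
  move=> KI; apply/bigcupsP => k /(subsetP KI).
  rewrite !inE => /predU1P[->|kI].
    by rewrite /add_elt (negPf ji) Sj subsetUl.
  rewrite /add_elt; case: ifP => _; first by apply: setUS; apply: bigcup_sup.
  by apply: subset_trans (subsetUr _ _); apply: bigcup_sup.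
have [jI|jI] := boolP (j \in I).
  apply: leq_trans (hS I) (subset_leq_card _).
  apply: subset_trans (sub I (subsetUr _ _)) _.
  by rewrite subUset subxx andbT -Sj bigcup_sup.
have := leq_trans (hS (j |: I)) (subset_leq_card (sub _ (subxx _))).
rewrite cardsU1 jI => /leq_trans/(_ (leq_card_setU _ _)).
by rewrite cards1 leq_add2l.
Qed.

Section Exchange.
Variables (i j : J) (a b : X) (S : J -> {set X}).
Hypotheses (aSi : a \in S i) (bSj : b \in S j).

(** A violator for [S] would have to contain [j] by the second hypothesis, but then
    [b \in S j] already lies in its union, so it also violates the first. *)
Lemma hall_exchange_and :
  hall (add_elt i b S) -> hall (add_elt j a S) -> hall S.
Proof.
move=> /forallP h1 /forallP h2; apply/forallP => I.
have [jI|jI] := boolP (j \in I).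
  apply: leq_trans (h1 I) (subset_leq_card _); apply/bigcupsP => k kI.
  move: kI; rewrite /add_elt; case: (k =P i) => [->|_] kI; last exact: bigcup_sup.
  rewrite subUset sub1set bigcup_sup // andbT.
  by apply/bigcupP; exists j.
apply: leq_trans (h2 I) (subset_leq_card _); apply/bigcupsP => k kI.
rewrite /add_elt; case: (k =P j) => [kj|_]; last exact: bigcup_sup.
by move: jI; rewrite -kj kI.
Qed.

(** If [I] and [K] violate Hall's condition for the two enlargements of one set, then
    their union violates it for the enlargement of both: [b] is provided by [S j]
    with [j \in I], [a] by [S i] with [i \in K], and submodularity of the size of a
    union bounds the total, since [I :&: K] avoids both [i] and [j]. *)
Lemma hall_exchange_or :
  hall (add_elt i b (add_elt j a S)) ->
  hall (add_elt i b S) || hall (add_elt j a S).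
Proof.
move=> /forallP h12; apply/norP => -[/hall_violator[I vI] /hall_violator[K vK]].
set UI := \bigcup_(k in I) _ in vI; set UK := \bigcup_(k in K) _ in vK.
have subI k : k \in I -> S k \subset UI.
  by move=> kI; apply: subset_trans (bigcup_sup k kI); apply: sub_add_elt.
have subK k : k \in K -> S k \subset UK.
  by move=> kK; apply: subset_trans (bigcup_sup k kK); apply: sub_add_elt.
have jI : j \in I.
  apply/negPn/negP => jI; move: (h12 I); rewrite leqNgt => /negP; apply.
  apply: leq_ltn_trans vI; apply/subset_leq_card/bigcupsP => k kI.
  apply: subset_trans (bigcup_sup k kI).
  rewrite /add_elt; case: (k =P j) => // kj; by rewrite -kj kI in jI.
have iI : i \notin I.
  apply/negP => iI; move: (h12 I); rewrite leqNgt => /negP; apply.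
  apply: leq_ltn_trans vI; apply/subset_leq_card/bigcupsP => k kI.
  have := bigcup_sup k kI (F := add_elt i b S); rewrite -/UI.
  have := subsetP (subI i iI) a aSi.
  rewrite /add_elt; do 2!case: ifP => //; rewrite !subUset !sub1set.
  - by move=> _ _ -> /andP[-> ->].
  - by move=> _ _ -> ->.
have iK : i \in K.
  apply/negPn/negP => iK; move: (h12 K); rewrite leqNgt => /negP; apply.
  apply: leq_ltn_trans vK; apply/subset_leq_card/bigcupsP => k kK.
  apply: subset_trans (bigcup_sup k kK).
  rewrite /add_elt; case: (k =P i) => // ki; by rewrite -ki kK in iK.
have jK : j \notin K.
  apply/negP => jK; move: (h12 K); rewrite leqNgt => /negP; apply.
  apply: leq_ltn_trans vK; apply/subset_leq_card/bigcupsP => k kK.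
  have := bigcup_sup k kK (F := add_elt j a S); rewrite -/UK.
  have := subsetP (subK j jK) b bSj.
  rewrite /add_elt; do 2!case: ifP => //; rewrite !subUset !sub1set.
  - by move=> _ _ -> /andP[-> ->].
  - by move=> _ _ -> ->.
have aK : a \in UK by apply: (subsetP (subK i iK)).
have bI : b \in UI by apply: (subsetP (subI j jI)).
have cU : #|I :|: K| <= #|UI :|: UK|.
  apply: leq_trans (h12 _) (subset_leq_card _).
  apply/bigcupsP => k; rewrite inE => kIK.
  have Sk : S k \subset UI :|: UK.
    case/orP: kIK => kk.
      by apply: subset_trans (subI _ kk) (subsetUl _ _).
    by apply: subset_trans (subK _ kk) (subsetUr _ _).
  by rewrite /add_elt; do 2!case: ifP => _; rewrite ?subUset ?sub1set ?inE ?aK ?bI ?orbT.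
have cI : #|I :&: K| <= #|UI :&: UK|.
  apply: leq_trans (h12 _) (subset_leq_card _).
  apply/bigcupsP => k; rewrite inE => /andP[kI kK].
  rewrite /add_elt; case: (k =P i) => [ki|_]; first by rewrite -ki kI in iI.
  case: (k =P j) => [kj|_]; first by rewrite -kj kK in jK.
  by rewrite subsetI subI ?subK.
have := leq_add cU cI; rewrite !cardsUI => /leq_trans/(_ (leq_add (leqnn _) (ltnW vK))).
by rewrite leq_add2r leqNgt vI.
Qed.

(** Seen as a function of whether [b] is added to [S i] and whether [a] is added to
    [S j], Hall's condition has no mixed second difference.  This is the source of
    all vanishing results for [mixed]. *)
Lemma hall_exchange :
  hall S + hall (add_elt i b (add_elt j a S))
    = hall (add_elt i b S) + hall (add_elt j a S).
Proof.
have m1 : hall S -> hall (add_elt i b S) by apply: hall_mono (sub_add_elt _ _ _).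
have m2 : hall S -> hall (add_elt j a S) by apply: hall_mono (sub_add_elt _ _ _).
have m3 : hall (add_elt j a S) -> hall (add_elt i b (add_elt j a S)).
  by apply: hall_mono (sub_add_elt _ _ _).
have m4 : hall (add_elt i b S) -> hall (add_elt i b (add_elt j a S)).
  apply: hall_mono => k; rewrite /add_elt; case: ifP => // _; last exact: sub_add_elt.
  by apply: setUS; apply: sub_add_elt.
have m5 : hall (add_elt i b S) && hall (add_elt j a S) -> hall S.
  by case/andP; apply: hall_exchange_and.
move: hall_exchange_or m1 m2 m3 m4 m5 => /implyP + /implyP + /implyP + /implyP + /implyP +
  /implyP.
by do 4!case: (hall _).
Qed.

End Exchange.
End HallCondition.

Local Open Scope ring_scope.

(** * Möbius inversion and the mixed form *)

Section Mobius.
Variables (R : numFieldType) (X : finType).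
Implicit Types (A B S : {set X}) (f g : {set X} -> R).

(** The inverse, up to the empty set, of the incidence matrix telling whether two
    sets meet: see [mobius_meet].  It is a product over the elements, so that sums
    over sets factor. *)
Definition mobius_kernel A S : R :=
  - \prod_x (if x \in A then (-1) ^+ (x \in S) else (x \in S)%:R).

(** At nonempty [S], the coefficient of the function [A |-> (A meets S)] in the
    expansion of a function [f] that vanishes at [set0]. *)
Definition mobius f S : R := \sum_A mobius_kernel A S * f A.

Lemma eq_mobius f g S : f =1 g -> mobius f S = mobius g S.
Proof. by move=> fg; apply: eq_bigr => A _; rewrite fg. Qed.

Lemma mobiusD f g S : mobius (fun A => f A + g A) S = mobius f S + mobius g S.
Proof. by rewrite /mobius -big_split; apply: eq_bigr => A _; rewrite mulrDr. Qed.

Lemma mobiusZ c f S : mobius (fun A => c * f A) S = c * mobius f S.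
Proof. by rewrite /mobius mulr_sumr; apply: eq_bigr => A _; rewrite mulrCA. Qed.

Lemma mobius_sum (K : finType) (c : K -> R) (f : K -> {set X} -> R) S :
  mobius (fun A => \sum_k c k * f k A) S = \sum_k c k * mobius (f k) S.
Proof.
under [RHS]eq_bigr do rewrite mulr_sumr.
rewrite exchange_big /=; apply: eq_bigr => A _.
by rewrite mulr_sumr; apply: eq_bigr => k _; rewrite mulrCA.
Qed.

Lemma mobius_0 f S : (forall A, f A = 0) -> mobius f S = 0.
Proof. by move=> f0; rewrite /mobius big1 // => A _; rewrite f0 mulr0. Qed.

Definition toggle (x : X) S : {set X} := [set z | (z == x) (+) (z \in S)].

Lemma toggleK x : involutive (toggle x).
Proof. by move=> S; apply/setP => z; rewrite !inE addbA addbb. Qed.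

Lemma toggle_notin x S : x \notin S -> toggle x S = x |: S.
Proof.
by move=> xS; apply/setP => z; rewrite !inE; case: eqP => // ->; rewrite (negPf xS).
Qed.

Lemma mobius_kernel_toggle x A S : x \in A -> mobius_kernel A (toggle x S) = - mobius_kernel A S.
Proof.
move=> xA; rewrite /mobius_kernel opprK (bigD1 x) //= xA inE eqxx addTb.
rewrite [in RHS](bigD1 x) //= xA.
under eq_bigr => z zx do rewrite inE (negPf zx) addFb.
by case: (x \in S); rewrite /= !expr0 !expr1; ring.
Qed.

Lemma mobius_kernel_eq0 x A S : x \notin A -> x \notin S -> mobius_kernel A S = 0.
Proof.
by move=> xA xS; rewrite /mobius_kernel (bigD1 x) //= (negPf xA) (negPf xS) mul0r oppr0.
Qed.

Lemma prod_indic (P : pred X) : \prod_x (P x)%:R = [forall x, P x]%:R :> R.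
Proof.
have [/forallP P1|] := boolP [forall x, P x]; first by rewrite big1 // => x _; rewrite P1.
by rewrite negb_forall => /existsP[x Px]; rewrite (bigD1 x) //= (negPf Px) mul0r.
Qed.

Lemma sum_prod_set (F : bool -> X -> R) :
  \sum_(S : {set X}) \prod_x F (x \in S) x = \prod_x (F true x + F false x).
Proof.
rewrite bigA_distr; apply: eq_big => [S|S _]; first by rewrite inE.
by apply: eq_bigr => x _; case: (x \in S).
Qed.

Lemma sum_mobius f : \sum_S mobius f S = - f set0.
Proof.
rewrite exchange_big /=.
have E A : \sum_S mobius_kernel A S = - (A == set0)%:R.
  rewrite sumrN (sum_prod_set (fun b x => if x \in A then (-1) ^+ b else b%:R)).
  rewrite (eq_bigr (fun x => (x \notin A)%:R)) => [|x _]; last first.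
    by case: (x \in A); rewrite /= !(expr0, expr1, addNr, addr0).
  congr (- _); rewrite prod_indic; congr (nat_of_bool _)%:R.
  apply/forallP/eqP => [A0|-> x]; last by rewrite inE.
  by apply/setP => x; rewrite inE; apply/negbTE.
rewrite (bigD1 set0) //= -mulr_suml E eqxx mulN1r big1 ?addr0 // => A A0.
by rewrite -mulr_suml E (negPf A0) oppr0 mul0r.
Qed.

Lemma mobius_disjoint S' S : mobius (fun A => (A :&: S' == set0)%:R) S = - (S == S')%:R.
Proof.
rewrite /mobius; pose F (b : bool) x : R :=
  if b then (-1) ^+ (x \in S) * (x \notin S')%:R else (x \in S)%:R.
transitivity (- \sum_(A : {set X}) \prod_x F (x \in A) x).
  rewrite -sumrN; apply: eq_bigr => A _; rewrite /mobius_kernel mulNr; congr (- _).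
  have -> : (A :&: S' == set0) = [forall x, (x \in A) ==> (x \notin S')].
    apply/eqP/forallP => [/setP AS x|AS].
      by have := AS x; rewrite !inE => /negbT; rewrite negb_and implybE.
    by apply/setP => x; have := AS x; rewrite !inE implybE -negb_and => /negbTE.
  rewrite -prod_indic -big_split /=; apply: eq_bigr => x _; rewrite /F.
  by case: (x \in A); rewrite /= ?mulr1.
congr (- _); rewrite sum_prod_set /F.
rewrite (eq_bigr (fun x => ((x \in S) == (x \in S'))%:R)) => [|x _]; last first.
  by case: (x \in S); case: (x \in S');
    rewrite /= ?expr0 ?expr1 ?mulr0 ?mulr1 ?add0r ?addr0 ?addNr.
rewrite prod_indic; congr (nat_of_bool _)%:R.
by apply/forallP/eqP => [eqS|-> x //]; apply/setP => x; apply/eqP.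
Qed.

Lemma mobius_const S : mobius (fun=> 1) S = - (S == set0)%:R.
Proof. by rewrite -mobius_disjoint; apply: eq_mobius => A; rewrite setI0 eqxx. Qed.

Lemma mobius_meet S' S :
  mobius (fun A => (A :&: S' != set0)%:R) S = (S == S')%:R - (S == set0)%:R.
Proof.
rewrite (@eq_mobius _ (fun A => 1 + (-1) * (A :&: S' == set0)%:R)) => [|A]; last first.
  by rewrite mulN1r; case: eqP; rewrite /= ?subrr ?subr0.
by rewrite mobiusD mobiusZ mobius_disjoint mobius_const mulN1r opprK addrC.
Qed.

End Mobius.

Definition incomparable (X : finType) (A B : {set X}) := ~~ (A \subset B) && ~~ (B \subset A).

Section MixedForm.
Variables (R : numFieldType) (J X : finType).
Implicit Types (F G : J -> {set X} -> R).

(** The symmetric multilinear form that takes the value [hall S] on the functions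
    [A |-> (A meets S j)]. *)
Definition mixed F : R :=
  \sum_(S : {ffun J -> {set X}}) (hall S)%:R * \prod_j mobius (F j) (S j).

Lemma eq_mixed F G : (forall j, F j =1 G j) -> mixed F = mixed G.
Proof.
move=> FG; apply: eq_bigr => S _; congr (_ * _).
by apply: eq_bigr => j _; apply: eq_mobius.
Qed.

Lemma mixed_eq0 F j : (forall A, F j A = 0) -> mixed F = 0.
Proof.
by move=> F0; apply: big1 => S _; rewrite (bigD1 j) //= mobius_0 // mul0r mulr0.
Qed.

Lemma mixedD F G :
  mixed (fun j A => F j A + G j A)
    = \sum_(K : {set J}) mixed (fun j => if j \in K then G j else F j).
Proof.
rewrite exchange_big /=; apply: eq_bigr => S _; rewrite -mulr_sumr; congr (_ * _).
rewrite (eq_bigr (fun j => mobius (G j) (S j) + mobius (F j) (S j))) => [|j _]; last first.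
  by rewrite mobiusD addrC.
rewrite bigA_distr; apply: eq_big => [K|K _]; first by rewrite inE.
by apply: eq_bigr => j _; case: ifP.
Qed.

Lemma mixedZ (c : R) (K : {set J}) F :
  mixed (fun j A => if j \in K then c * F j A else F j A) = c ^+ #|K| * mixed F.
Proof.
rewrite mulr_sumr; apply: eq_bigr => S _; rewrite mulrCA; congr (_ * _).
rewrite -prodr_const [X in _ = X * _]big_mkcond -big_split /=; apply: eq_bigr => j _.
by case: ifP => _; rewrite ?mobiusZ ?mul1r.
Qed.

Lemma mixed_perm F (s : {perm J}) : mixed (F \o s) = mixed F.
Proof.
rewrite /mixed (reindex_onto (fun S : {ffun J -> {set X}} => [ffun j => S (s j)])
  (fun S => [ffun j => S ((s^-1)%g j)])) /=; last first.
  by move=> S _; apply/ffunP => j; rewrite !ffunE permK.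
rewrite (eq_bigl predT) => [|S]; last first.
  by apply/eqP/ffunP => j; rewrite !ffunE permKV.
apply: eq_bigr => S _; congr ((nat_of_bool _)%:R * _).
  have -> : hall [ffun j => S (s j)] = hall (S \o s) by apply: eq_hall => j; rewrite ffunE.
  apply/idP/idP => hS; last by apply: hall_inj => //; apply: perm_inj.
  have := hall_inj (@perm_inj _ (s^-1)%g) hS.
  by rewrite (@eq_hall _ _ _ S) // => j /=; rewrite permKV.
rewrite [RHS](reindex_inj (@perm_inj _ s)).
by apply: eq_bigr => j _; rewrite ffunE.
Qed.

(** By multilinearity the two arguments are indicators of incomparable sets [A] and
    [B]; choose [b \in A :\: B] and [a \in B :\: A].  The Möbius kernel changes sign
    when [b] is toggled in [S i] or [a] in [S j], and it vanishes unless
    [a \in S i] and [b \in S j]; hence only the mixed second difference of Hall's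
    condition contributes, and this is zero by [hall_exchange]. *)
Lemma mixed_incomparable F i j : i != j ->
  (forall A B, F i A != 0 -> F j B != 0 -> incomparable A B) -> mixed F = 0.
Proof.
move=> ij incF.
pose rest (S : {ffun J -> {set X}}) :=
  \prod_(k | (k != i) && (k != j)) mobius (F k) (S k).
transitivity (\sum_(A : {set X}) \sum_(B : {set X}) F i A * F j B *
    \sum_(S : {ffun J -> {set X}}) (hall S)%:R * (mobius_kernel R A
      (S i) * mobius_kernel R B (S j) * rest S)).
  under [RHS]eq_bigr => A _.
    under eq_bigr do rewrite mulr_sumr.
    rewrite exchange_big /=; over.
  rewrite exchange_big /=; apply: eq_bigr => S _.
  rewrite (bigD1 i) //= (bigD1 j) 1?eq_sym //= -/(rest S).
  rewrite {1}/mobius !mulr_suml mulr_sumr; apply: eq_bigr => A _.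
  rewrite !(mulr_suml, mulr_sumr); apply: eq_bigr => B _; ring.
apply: big1 => A _; apply: big1 => B _.
have [->|FA] := eqVneq (F i A) 0; first by rewrite !mul0r.
have [->|FB] := eqVneq (F j B) 0; first by rewrite mulr0 mul0r.
have /andP[/subsetPn[b bA bB] /subsetPn[a aB aA]] := incF A B FA FB.
apply/eqP; rewrite mulf_eq0; apply/orP; right; apply/eqP.
pose tog k x (S : {ffun J -> {set X}}) : {ffun J -> {set X}} :=
  [ffun l => if l == k then toggle x (S l) else S l].
have togK k x : involutive (tog k x).
  by move=> S; apply/ffunP => l; rewrite !ffunE; case: eqP => // _; rewrite toggleK.
pose W (S : {ffun J -> {set X}}) := mobius_kernel R A (S i) * mobius_kernel R B (S j) * rest S.
have Wi S : W (tog i b S) = - W S.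
  rewrite /W /tog !ffunE eqxx eq_sym (negPf ij) mobius_kernel_toggle // 2!mulNr.
  congr (- (_ * _)); apply: eq_bigr => k /andP[/negPf ki _]; by rewrite ffunE ki.
have Wj S : W (tog j a S) = - W S.
  rewrite /W /tog !ffunE eqxx (negPf ij) mobius_kernel_toggle // mulrN mulNr.
  congr (- (_ * _)); apply: eq_bigr => k /andP[_ /negPf kj]; by rewrite ffunE kj.
pose T : R := \sum_(S : {ffun J -> {set X}}) (hall S)%:R * W S.
pose q (S : {ffun J -> {set X}}) : R := (hall S)%:R - (hall (tog i b S))%:R
   - (hall (tog j a S))%:R + (hall (tog i b (tog j a S)))%:R.
have q_i S : q (tog i b S) = - q S.
  have C : tog i b (tog j a (tog i b S)) = tog j a S.
    apply/ffunP => k; rewrite !ffunE; have [->|_] := eqVneq k i.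
      by rewrite (negPf ij) toggleK.
    by case: eqP.
  have C' : tog j a (tog i b S) = tog i b (tog j a S).
    by rewrite -[LHS](togK i b) C.
  by rewrite /q togK C C'; ring.
have q_j S : q (tog j a S) = - q S by rewrite /q togK; ring.
(* Reindexing by the toggles shows that each of the four terms of q gives T. *)
have T4 : \sum_S q S * W S = T *+ 4.
  rewrite /q; under eq_bigr do rewrite !(mulrDl, mulNr).
  rewrite !big_split /= !sumrN.
  have -> : \sum_(S : {ffun J -> {set X}}) (hall (tog i b S))%:R * W S = - T.
    rewrite (reindex_inj (inv_inj (togK i b))) -sumrN /=.
    by apply: eq_bigr => S _; rewrite togK Wi mulrN.
  have -> : \sum_(S : {ffun J -> {set X}}) (hall (tog j a S))%:R * W S = - T.
    rewrite (reindex_inj (inv_inj (togK j a))) -sumrN /=.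
    by apply: eq_bigr => S _; rewrite togK Wj mulrN.
  have -> : \sum_(S : {ffun J -> {set X}}) (hall (tog i b (tog j a S)))%:R * W S = T.
    rewrite (reindex_inj (inv_inj (togK j a))) (reindex_inj (inv_inj (togK i b))) /=.
    by apply: eq_bigr => S _; rewrite !togK Wj Wi opprK.
  by rewrite -/T; ring.
suff q0 S : q S * W S = 0.
  by move: T4; rewrite big1 // => /esym/eqP; rewrite mulrn_eq0 /= => /eqP.
have [->|W0] := eqVneq (W S) 0; first by rewrite mulr0.
have aSi : a \in S i.
  by apply: contraNT W0 => aSi; rewrite /W (mobius_kernel_eq0 _ aA aSi) !mul0r.
have bSj : b \in S j.
  by apply: contraNT W0 => bSj; rewrite /W (mobius_kernel_eq0 _ bB bSj) mulr0 mul0r.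
suff -> : q S = 0 by rewrite mul0r.
wlog bSi : S aSi bSj {W0} / b \notin S i.
  move=> wl; have [bSi|] := boolP (b \in S i); last exact: wl.
  apply/eqP; rewrite -oppr_eq0 -q_i; apply/eqP/wl; rewrite ffunE ?eqxx.
  - rewrite inE; case: eqP => [ab|_]; [|by rewrite addFb].
    by rewrite -ab aB in bB.
  - by rewrite eq_sym (negPf ij).
  - by rewrite inE eqxx bSi.
wlog aSj : S aSi bSj bSi / a \notin S j.
  move=> wl; have [aSj|] := boolP (a \in S j); last exact: wl.
  apply/eqP; rewrite -oppr_eq0 -q_j; apply/eqP/wl; rewrite ffunE ?(negPf ij) ?eqxx //.
  - rewrite inE; case: eqP => [ab|_]; [|by rewrite addFb].
    by rewrite -ab bA in aA.
  - by rewrite inE eqxx aSj.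
have := hall_exchange aSi bSj.
rewrite /q.
rewrite (@eq_hall _ _ (tog i b S) (add_elt i b S)) => [|k]; last first.
  by rewrite ffunE /add_elt; case: eqP => // ->; rewrite toggle_notin.
rewrite (@eq_hall _ _ (tog j a S) (add_elt j a S)) => [|k]; last first.
  by rewrite ffunE /add_elt; case: eqP => // ->; rewrite toggle_notin.
rewrite (@eq_hall _ _ (tog i b (tog j a S)) (add_elt i b (add_elt j a S))) => [|k]; last first.
  rewrite /add_elt !ffunE; case: (k =P i) => [->|_].
    by rewrite (negPf ij) toggle_notin.
  by case: eqP => // ->; rewrite toggle_notin.
move=> E; have := congr1 (fun m : nat => m%:R : R) E; rewrite /= !natrD => {}E.
by rewrite -[X in X + _]addrA -opprD -E; ring.
Qed.

(** As soon as one argument is incomparable with [v], adding [v] to any of the other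
    arguments is invisible. *)
Lemma mixed_shift F F' i v :
  (forall A B, F i A != 0 -> v B != 0 -> incomparable A B) ->
  F' i = F i ->
  (forall j, F' j =1 F j \/ (forall A, F' j A = F j A + v A)) ->
  mixed F' = mixed F.
Proof.
move=> inc Fi HF.
pose G j A := F' j A - F j A.
rewrite (@eq_mixed F' (fun j A => F j A + G j A)) => [|j A]; last by rewrite /G; ring.
rewrite mixedD (bigD1 set0) //= [X in _ + X]big1 ?addr0 => [|K K0].
  by apply: eq_mixed => j; rewrite inE.
have [iK|iK] := boolP (i \in K).
  by apply: (@mixed_eq0 _ i) => A; rewrite iK /G Fi subrr.
have /set0Pn[j jK] := K0.
have [E|E] := HF j.
  by apply: (@mixed_eq0 _ j) => A; rewrite jK /G E subrr.
apply: (@mixed_incomparable _ i j).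
  by apply: contraNneq iK => ->.
move=> A B; rewrite (negPf iK) jK /G E addrAC subrr add0r; exact: inc.
Qed.

End MixedForm.

(** * Splitting off the first coordinate *)

Section Cons.
Variable n : nat.

(** The subsets of ['I_n.+1] are pairs of a bit for [ord0] and a subset of ['I_n]. *)
Definition set_cons (b : bool) (A : {set 'I_n}) : {set 'I_n.+1} :=
  [set i | if unlift ord0 i is Some j then j \in A else b].

Definition set_tail (A : {set 'I_n.+1}) : {set 'I_n} := [set j | lift ord0 j \in A].

Lemma in_set_cons0 b A : (ord0 \in set_cons b A) = b.
Proof. by rewrite inE unlift_none. Qed.

Lemma in_set_consS b A j : (lift ord0 j \in set_cons b A) = (j \in A).
Proof. by rewrite inE liftK. Qed.

Lemma set_cons_setP (A B : {set 'I_n.+1}) :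
  (ord0 \in A) = (ord0 \in B) -> set_tail A = set_tail B -> A = B.
Proof.
move=> AB0 /setP AB; apply/setP => i; case: (unliftP ord0 i) => [j|] -> //.
by have := AB j; rewrite !inE.
Qed.

Lemma set_tail_cons b A : set_tail (set_cons b A) = A.
Proof. by apply/setP => j; rewrite inE in_set_consS. Qed.

Lemma set_cons_eta (A : {set _}) : set_cons (ord0 \in A) (set_tail A) = A.
Proof. by apply: set_cons_setP; rewrite ?in_set_cons0 ?set_tail_cons. Qed.

Lemma set_cons_false0 : set_cons false set0 = set0.
Proof.
by apply: set_cons_setP; rewrite ?in_set_cons0 ?inE // set_tail_cons; apply/setP => j;
  rewrite !inE.
Qed.

Lemma set_cons_true A : set_cons true A = ord0 |: set_cons false A.
Proof.
apply: set_cons_setP; first by rewrite in_set_cons0 !inE eqxx.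
by rewrite set_tail_cons; apply/setP => j; rewrite !inE liftK.
Qed.

Lemma set_cons_subset b c A B : (set_cons b A \subset set_cons c B) = (b ==> c) && (A \subset B).
Proof.
apply/subsetP/andP => [AB|[bc /subsetP AB] i].
  split; first by have := AB ord0; rewrite !in_set_cons0 => /implyP.
  by apply/subsetP => j; have := AB (lift ord0 j); rewrite !in_set_consS.
case: (unliftP ord0 i) => [j|] ->; first by rewrite !in_set_consS; apply: AB.
by rewrite !in_set_cons0; apply/implyP.
Qed.

Lemma set_consU b c A B : set_cons b A :|: set_cons c B = set_cons (b || c) (A :|: B).
Proof.
apply: set_cons_setP; first by rewrite inE !in_set_cons0.
by rewrite set_tail_cons; apply/setP => j; rewrite !inE !liftK.
Qed.

Lemma card_set_cons b A : #|set_cons b A| = (b + #|A|)%N.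
Proof.
rewrite -!sum1_card !big_mkcond big_ord_recl /= in_set_cons0; congr (_ + _)%N.
  rewrite [RHS]big_mkcond.
by apply: eq_bigr => j _; rewrite in_set_consS.
Qed.

Lemma big_set_cons (R : Type) (idx : R) (op : Monoid.com_law idx) (F : {set 'I_n.+1} -> R) :
  \big[op/idx]_A F A = \big[op/idx]_b \big[op/idx]_A F (set_cons b A).
Proof.
rewrite pair_big /= (reindex (fun p : bool * {set 'I_n} => set_cons p.1 p.2)) //=.
exists (fun A : {set 'I_n.+1} => (ord0 \in A, set_tail A)) => [[b A] _|A _] /=.
  by rewrite in_set_cons0 set_tail_cons.
exact: set_cons_eta.
Qed.

Definition ffun_cons (T : Type) (a : T) (f : {ffun 'I_n -> T}) : {ffun 'I_n.+1 -> T} :=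
  [ffun i => if unlift ord0 i is Some j then f j else a].

Lemma ffun_cons0 (T : Type) (a : T) f : ffun_cons a f ord0 = a.
Proof. by rewrite ffunE unlift_none. Qed.

Lemma ffun_consS (T : Type) (a : T) f j : ffun_cons a f (lift ord0 j) = f j.
Proof. by rewrite ffunE liftK. Qed.

Lemma ffun_cons_eta (T : Type) (f : {ffun 'I_n.+1 -> T}) :
  ffun_cons (f ord0) [ffun j => f (lift ord0 j)] = f.
Proof.
by apply/ffunP => i; case: (unliftP ord0 i) => [j|] ->; rewrite ?ffun_cons0 ?ffun_consS ?ffunE.
Qed.

Lemma big_ffun_cons (T : finType) (R : Type) (idx : R) (op : Monoid.com_law idx)
    (F : {ffun 'I_n.+1 -> T} -> R) :
  \big[op/idx]_f F f = \big[op/idx]_a \big[op/idx]_f F (ffun_cons a f).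
Proof.
rewrite pair_big /= (reindex (fun p : T * {ffun 'I_n -> T} => ffun_cons p.1 p.2)) //=.
exists (fun f : {ffun 'I_n.+1 -> T} => (f ord0, [ffun j => f (lift ord0 j)])) => [[a f] _|f _] /=.
  rewrite ffun_cons0; congr (_, _); apply/ffunP => j; by rewrite ffunE ffun_consS.
exact: ffun_cons_eta.
Qed.

End Cons.

Lemma bigcup_set_cons (n m : nat) b (I : {set 'I_n}) (F : 'I_n.+1 -> {set 'I_m}) :
  \bigcup_(i in set_cons b I) F i
    = (if b then F ord0 else set0) :|: \bigcup_(i in I) F (lift ord0 i).
Proof.
rewrite big_mkcond big_ord_recl /= in_set_cons0; congr (_ :|: _).
by rewrite [RHS]big_mkcond; apply: eq_bigr => j _; rewrite in_set_consS.
Qed.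

Section HallPeel.
Variable n : nat.
Implicit Types (S : 'I_n.+1 -> {set 'I_n.+1}).

Lemma bigcup_no_head (I : {set 'I_n}) (F : 'I_n -> {set 'I_n}) :
  \bigcup_(i in I) set_cons false (F i) = set_cons false (\bigcup_(i in I) F i).
Proof.
rewrite (big_morph (set_cons false) (id1 := set0) (op1 := @setU _)) //.
  by move=> A B; rewrite set_consU.
exact: set_cons_false0.
Qed.

(** The [n.+1] sets share only [n] elements. *)
Lemma hall_no_head S : (forall i, ord0 \notin S i) -> hall S = false.
Proof.
move=> S0; apply/negP => /forallP/(_ setT).
rewrite cardsT card_ord leqNgt => /negP; apply.
have /subset_leq_card : \bigcup_(i in setT) S i \subset set_cons false setT.
  apply/bigcupsP => i _; rewrite -[S i]set_cons_eta set_cons_subset (negPf (S0 i)) /=.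
  exact: subsetT.
by rewrite card_set_cons cardsT card_ord.
Qed.

Lemma hall_head S :
  ord0 \in S ord0 -> (forall j, ord0 \notin S (lift ord0 j)) ->
  hall S = hall (fun j => set_tail (S (lift ord0 j))).
Proof.
move=> S0 Sj.
have U (I : {set 'I_n}) : \bigcup_(i in I) S (lift ord0 i)
    = set_cons false (\bigcup_(i in I) set_tail (S (lift ord0 i))).
  rewrite -bigcup_no_head; apply: eq_bigr => i _.
  by rewrite -[LHS]set_cons_eta (negPf (Sj i)).
apply/forallP/forallP => hS I.
  by have := hS (set_cons false I); rewrite card_set_cons bigcup_set_cons U set0U card_set_cons.
rewrite -[I]set_cons_eta card_set_cons bigcup_set_cons U.
case: (ord0 \in I); last by rewrite set0U card_set_cons; apply: hS.
rewrite -[S ord0]set_cons_eta S0 set_consU card_set_cons leq_add2l.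
by apply: leq_trans (hS _) (subset_leq_card (subsetUr _ _)).
Qed.

End HallPeel.

Section Peel.
Variables (R : numFieldType) (n : nat).
Implicit Types (f g : {set 'I_n.+1} -> R) (k : {set 'I_n} -> R).

Lemma mobius_set_cons f s S :
  mobius f (set_cons s S) = (-1) ^+ s * mobius (fun A => f (set_cons true A)) S
                      + s%:R * mobius (fun A => f (set_cons false A)) S.
Proof.
have kernelE a A : mobius_kernel R (set_cons a A) (set_cons s S) =
    (if a then (-1) ^+ s else s%:R) * mobius_kernel R A S.
  rewrite /mobius_kernel big_ord_recl !in_set_cons0 mulrN; congr (- (_ * _)).
  by apply: eq_bigr => j _; rewrite !in_set_consS.
rewrite {1}/mobius big_set_cons big_bool /= /mobius !mulr_sumr.
by congr (_ + _); apply: eq_bigr => A _; rewrite kernelE mulrA.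
Qed.

(** The function [k], extended so as to ignore [ord0], plus [t] times the support
    function of the segment in the direction of [ord0]. *)
Definition lift_fun k (t : R) : {set 'I_n.+1} -> R :=
  fun A => k (set_tail A) + t * (ord0 \in A)%:R.

Lemma mobius_lift_fun k t S : mobius (lift_fun k t) S =
  if ord0 \in S then t * (set_tail S == set0)%:R
  else mobius k (set_tail S) - t * (set_tail S == set0)%:R.
Proof.
rewrite -[S in LHS]set_cons_eta mobius_set_cons.
rewrite (@eq_mobius _ _ _ (fun A => k A + t * 1)) => [|A]; last first.
  by rewrite /lift_fun in_set_cons0 set_tail_cons.
rewrite (@eq_mobius _ _ (fun A => lift_fun k t (set_cons false A)) k) => [|A]; last first.
  by rewrite /lift_fun in_set_cons0 set_tail_cons mulr0 addr0.
rewrite mobiusD mobiusZ mobius_const.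
case: (ord0 \in S); rewrite /= ?expr0 ?expr1 ?mul0r ?mul1r; ring.
Qed.

(** Only the first set can be matched with [ord0].  If another set is [{ord0}], then
    adding [ord0] to the first set changes nothing, and the two contributions
    cancel; otherwise the other sets avoid [ord0], and by Hall's condition the first
    set contains it and serves no other purpose. *)
Lemma mixed_peel g k t : (forall A, g (set_cons false A) = 0) ->
  mixed (fun j : 'I_n.+1 => if j == ord0 then g else lift_fun k t)
    = g (set_cons true set0) * mixed (fun _ : 'I_n => k).
Proof.
move=> g0.
pose term (S : {ffun 'I_n -> {set 'I_n.+1}}) : R :=
  (\prod_j mobius (lift_fun k t) (S j)) *
  \sum_(S1 : {set 'I_n}) mobius (fun A => g (set_cons true A)) S1 *
     ((hall (ffun_cons (set_cons false S1) S))%:R - (hall (ffun_cons (set_cons true S1) S))%:R).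
transitivity (\sum_S term S).
  rewrite /mixed big_ffun_cons exchange_big /=; apply: eq_bigr => S _.
  rewrite /term big_set_cons big_bool /= mulr_sumr -big_split /=.
  apply: eq_bigr => S1 _.
  rewrite !big_ord_recl /= !ffun_cons0 !mobius_set_cons /= !(mobius_0 _ g0) expr0 expr1.
  have E a : \prod_(j < n) mobius (lift_fun k t) (ffun_cons a S (lift ord0 j))
      = \prod_j mobius (lift_fun k t) (S j) by apply: eq_bigr => j _; rewrite ffun_consS.
  rewrite !E.
  ring.
pose tl (S : {ffun 'I_n -> {set 'I_n.+1}}) := [ffun j => set_tail (S j)].
have termE S : term S = if [forall j, ord0 \notin S j] then
    g (set_cons true set0) * ((hall (tl S))%:R * \prod_j mobius k (tl S j)) else 0.
  case: ifPn => [/forallP S0|].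
    have hE S1 : (hall (ffun_cons (set_cons false S1) S))%:R - (hall (ffun_cons
      (set_cons true S1) S))%:R
        = - (hall (tl S))%:R :> R.
      rewrite hall_no_head ?sub0r => [|i]; last first.
        by case: (unliftP ord0 i) => [j|] ->; rewrite ?ffun_cons0 ?in_set_cons0 ?ffun_consS.
      rewrite hall_head ?ffun_cons0 ?in_set_cons0 => // [|j]; last by rewrite ffun_consS.
      by congr (- (nat_of_bool _)%:R); apply: eq_hall => j; rewrite ffun_consS ffunE.
    rewrite /term (eq_bigr _ (fun S1 _ => congr1 (fun z => _ * z) (hE S1))).
    rewrite -mulr_suml sum_mobius mulrN mulNr opprK.
    case: (boolP (hall (tl S))) => [hS|_]; last by rewrite mul0r !mulr0.
    rewrite mulr1 mul1r mulrC; congr (_ * _); apply: eq_bigr => j _.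
    have := hall_neq0 j hS; rewrite ffunE mobius_lift_fun (negPf (S0 j)) => /negPf ->.
    by rewrite mulr0 subr0.
  rewrite negb_forall => /existsP[j]; rewrite negbK => Sj.
  have [/eqP S0|S0] := boolP (set_tail (S j) == set0); last first.
    by rewrite /term (bigD1 j) //= mobius_lift_fun Sj (negPf S0) mulr0 !mul0r.
  rewrite /term [X in _ * X]big1 ?mulr0 // => S1 _.
  rewrite [X in _%:R - X%:R](_ : _ =
    hall (ffun_cons (set_cons false S1) S) :> nat) ?subrr ?mulr0 //.
  congr (nat_of_bool _).
  rewrite -(@hall_add_singleton _ _ ord0 (lift ord0 j) ord0 (ffun_cons (set_cons false S1) S)) //.
    apply: eq_hall => i; rewrite /add_elt; case: (unliftP ord0 i) => [l|] ->.
      by rewrite !ffun_consS.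
    by rewrite !ffun_cons0 set_cons_true.
  rewrite ffun_consS -[S j]set_cons_eta Sj S0 set_cons_true set_cons_false0 setU0 //.
rewrite (eq_bigr _ (fun S _ => termE S)) -big_mkcond /= /mixed mulr_sumr.
rewrite (reindex (fun S : {ffun 'I_n -> {set 'I_n}} =>
  [ffun j => set_cons false (S j)])) /=; last first.
  exists tl => [S _|S]; first by apply/ffunP => j; rewrite !ffunE set_tail_cons.
  move=> /forallP S0; apply/ffunP => j; rewrite !ffunE -[RHS]set_cons_eta.
  by rewrite (negPf (S0 j)).
apply: eq_big => [S|S _]; first by apply/forallP => j; rewrite ffunE in_set_cons0.
have -> : tl [ffun j => set_cons false (S j)] = S; last by [].
by apply/ffunP => j; rewrite !ffunE set_tail_cons.
Qed.

End Peel.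

(** * The candidate volume as a function of rank functions *)

Section PolyVol.
Variable R : numFieldType.

(** For monotone submodular [f] with [f set0 = 0], the volume of the polymatroid
    of [f]. *)
Definition hall_vol n (f : {set 'I_n} -> R) : R := mixed (fun _ : 'I_n => f) / n`!%:R.

Lemma eq_hall_vol n (f g : {set 'I_n} -> R) : f =1 g -> hall_vol f = hall_vol g.
Proof. by move=> fg; rewrite /hall_vol; congr (_ / _); apply: eq_mixed. Qed.

Lemma hall_vol_dim0 (f : {set 'I_0} -> R) : hall_vol f = 1.
Proof.
rewrite /hall_vol fact0 divr1 /mixed.
rewrite (eq_bigr (fun=> 1)) => [|S _]; last first.
  rewrite big_ord0 mulr1; have -> // : hall S.
  by apply/forallP => I; rewrite (leq_trans (max_card _)) // card_ord.
by rewrite sumr_const card_ffun card_ord expn0.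
Qed.

(** Perturbations on mutually incomparable families of sets do not interact. *)
Lemma hall_vol_incomparable n (f u v : {set 'I_n} -> R) :
  (forall A B, u A != 0 -> v B != 0 -> incomparable A B) ->
  hall_vol (fun A => f A + u A + v A) + hall_vol f
    = hall_vol (fun A => f A + u A) + hall_vol (fun A => f A + v A).
Proof.
move=> inc; rewrite /hall_vol -!mulrDl; congr (_ / _).
have E1 : mixed (fun _ : 'I_n => fun A => f A + u A + v A) =
    \sum_(K : {set 'I_n}) mixed (fun j => if j \in K then u else fun A => f A + v A).
  by rewrite -mixedD; apply: eq_mixed => j A; ring.
rewrite E1 mixedD (bigD1 set0) //= [in RHS](bigD1 set0) //=.
rewrite (@eq_mixed _ _ _ (fun j => if j \in set0 then u else fun A => f A +
  v A) (fun _ A => f A + v A)) => [|j A]; last by rewrite inE.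
rewrite (@eq_mixed _ _ _ (fun j => if j \in set0 then u else f) (fun _ => f)) => [|j A];
  last by rewrite inE.
rewrite (eq_bigr (fun K : {set 'I_n} => mixed (fun j => if j \in K then u else f))).
  by ring.
move=> K /set0Pn[i iK].
apply: (@mixed_shift _ _ _ _ _ i v); rewrite ?iK //.
by move=> j; case: ifP => _; [left | right].
Qed.

(** The polynomial [s |-> hall_vol (f + s g)]. *)
Definition ray_poly n (f g : {set 'I_n} -> R) : {poly R} :=
  \sum_(K : {set 'I_n}) (mixed (fun j => if j \in K then g else f) / n`!%:R) *: 'X^#|K|.

Lemma ray_polyE n (f g : {set 'I_n} -> R) s :
  (ray_poly f g).[s] = hall_vol (fun A => f A + s * g A).
Proof.
rewrite /ray_poly horner_sum /hall_vol mixedD mulr_suml; apply: eq_bigr => K _.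
rewrite !hornerE mulrAC; congr (_ / _).
rewrite mulrC -(mixedZ s K); apply: eq_mixed => j A; by case: (j \in K).
Qed.

(** The [n.+1] positions of [g] contribute equally by symmetry of [mixed]. *)
Lemma ray_poly_deriv0 n (f g : {set 'I_n.+1} -> R) :
  (ray_poly f g)^`().[0] =
  mixed (fun j : 'I_n.+1 => if j == ord0 then g else f) / n`!%:R.
Proof.
rewrite horner_coef0 coef_deriv mulr1n /ray_poly coef_sum.
rewrite (bigID (fun K : {set 'I_n.+1} => #|K| == 1%N)) /= addrC big1 ?add0r => [|K K1];
  last first.
  by rewrite coefZ coefXn eq_sym (negPf K1) mulr0.
rewrite big_cards1 (eq_bigr (fun=> mixed
  (fun j : 'I_n.+1 => if j == ord0 then g else f) / n.+1`!%:R)) => [|i _]; last first.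
  rewrite coefZ coefXn cards1 eqxx mulr1; congr (_ / _).
  rewrite -[RHS](mixed_perm _ (tperm ord0 i)); apply: eq_mixed => j A /=.
  rewrite inE; congr ((if _ then _ else _) A).
  by rewrite -(inj_eq (@perm_inj _ (tperm ord0 i)) j i) tpermR.
rewrite sumr_const card_ord factS natrM.
have n0 : n.+1%:R != 0 :> R by rewrite pnatr_eq0.
by rewrite -[LHS]mulr_natr invfM -!mulrA; congr (_ * _); rewrite mulrC -mulrA mulfV ?mulr1.
Qed.

(** On a family [D] of sets closed under taking subsets, the constraint [x_0 <= t] is
    tight for [f].  The values of [f] at sets outside [D] that avoid [ord0] are
    invisible next to the indicator of the sets [ord0 |: A] with [A] in [D]; so [f]
    may be replaced by a function to which [mixed_peel] applies. *)
Lemma mixed_truncation n (f : {set 'I_n.+1} -> R) (D : pred {set 'I_n}) t :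
  D set0 -> (forall A B : {set 'I_n}, A \subset B -> D B -> D A) ->
  (forall A, D A -> f (set_cons true A) = f (set_cons false A) + t) ->
  mixed (fun j : 'I_n.+1 =>
      if j == ord0 then fun A : {set 'I_n.+1} => ((ord0 \in A) && D (set_tail A))%:R else f)
    = mixed (fun _ : 'I_n => fun A => f (set_cons true A) - t).
Proof.
move=> D0 Dsub fD; pose g (A : {set 'I_n.+1}) : R := ((ord0 \in A) && D (set_tail A))%:R.
set k := fun A => f (set_cons true A) - t.
have g0 A : g (set_cons false A) = 0 by rewrite /g in_set_cons0.
transitivity (mixed (fun j : 'I_n.+1 => if j == ord0 then g else lift_fun k t)); last first.
  by rewrite mixed_peel // /g in_set_cons0 set_tail_cons D0 mul1r.
apply/esym/(@mixed_shift _ _ _ _ _ ord0 (fun A => lift_fun k t A - f A)).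
- move=> A B /=; rewrite /g -[A]set_cons_eta -[B]set_cons_eta in_set_cons0 set_tail_cons /incomparable.
  rewrite /lift_fun !set_tail_cons !in_set_cons0 !set_cons_subset.
  case: (boolP (ord0 \in A)) => [_|_]; last by rewrite eqxx.
  case: (boolP (ord0 \in B)) => [_|_] /=; first by rewrite /k mulr1 subrK subrr eqxx.
  case: (boolP (D (set_tail A))) => [DA _|_]; last by rewrite eqxx.
  rewrite mulr0 addr0 => kB; apply: contraNN kB => sub.
  by rewrite /k fD ?addrK ?subrr // (Dsub _ _ sub).
- by [].
move=> j; case: ifP => _; [by left | right => A]; ring.
Qed.

Lemma ray_poly_truncation n (f : {set 'I_n.+1} -> R) (D : pred {set 'I_n}) t :
  D set0 -> (forall A B : {set 'I_n}, A \subset B -> D B -> D A) ->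
  (forall A, D A -> f (set_cons true A) = f (set_cons false A) + t) ->
  (ray_poly f (fun A : {set 'I_n.+1} => ((ord0 \in A) && D (set_tail A))%:R))^`().[0]
    = hall_vol (fun A => f (set_cons true A) - t).
Proof.
by move=> D0 Dsub fD; rewrite ray_poly_deriv0 (@mixed_truncation _ _ _ t).
Qed.

End PolyVol.

(** * Draconian sums *)

Section Multinomial.
Variable m : nat.
Implicit Types (a : 'I_m -> nat).

Definition fiber_card n (phi : {ffun 'I_n -> 'I_m}) (i : 'I_m) : nat :=
  \sum_(j < n) (phi j == i).

Lemma sum_fiber_card n (phi : {ffun 'I_n -> 'I_m}) :
  (\sum_i fiber_card phi i = n)%N.
Proof.
rewrite exchange_big /= -[RHS](card_ord n) -sum1_card; apply: eq_bigr => j _.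
by rewrite (bigD1 (phi j)) //= eqxx big1 ?addn0 // => i /negPf; rewrite eq_sym => ->.
Qed.

Lemma fiber_card_cons n k (phi : {ffun 'I_n -> 'I_m}) i :
  fiber_card (ffun_cons k phi) i = ((k == i) + fiber_card phi i)%N.
Proof.
rewrite /fiber_card big_ord_recl ffun_cons0; congr (_ + _)%N.
by apply: eq_bigr => j _; rewrite ffun_consS.
Qed.

(** Induction on [n]: removing the value of [phi] at [ord0] lowers one fiber by one,
    and the [a k] add up to [n]. *)
Lemma multinomial_card n a : (\sum_i a i = n)%N ->
  (\sum_(phi : {ffun 'I_n -> 'I_m}) [forall i, fiber_card phi i == a i]
     * \prod_i (a i)`!)%N = n`!.
Proof.
elim: n a => [|n IH] a sa.
  have a0 i : a i = 0%N by apply/eqP; move/eqP: sa; rewrite sum_nat_eq0 => /forallP/(_ i).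
  rewrite fact0 -[RHS](expn0 #|'I_m|) -[X in (_ ^ X)%N](card_ord 0) -card_ffun -sum1_card.
  apply: eq_bigr => phi _; rewrite big1 => [|i _]; last by rewrite a0.
  rewrite muln1; have -> // : [forall i, fiber_card phi i == a i].
  by apply/forallP => i; rewrite /fiber_card big_ord0 a0.
rewrite big_ffun_cons /=.
transitivity (\sum_(k < m) (a k * n`!))%N; last by rewrite -big_distrl /= sa factS.
apply: eq_bigr => k _.
case E: (a k) => [|p].
  rewrite mul0n big1 // => phi _;
    have -> // : [forall i, fiber_card (ffun_cons k phi) i == a i] = false.
  by apply/forallP => /(_ k); rewrite fiber_card_cons eqxx E.
pose b i := (a i - (k == i))%N.
have ab i : (a i = (k == i) + b i)%N.
  by rewrite /b; case: eqP => [<-|_]; rewrite ?E ?subn0 //= subn1.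
have sb : (\sum_i b i = n)%N.
  move: sa; rewrite (eq_bigr _ (fun i _ => ab i)) big_split /= (bigD1 k) //= eqxx.
  by rewrite big1 ?addn0 ?add1n => [[]|i /negPf] //; rewrite eq_sym => ->.
rewrite -(IH b sb) big_distrr /=; apply: eq_bigr => phi _.
have -> : [forall i, fiber_card (ffun_cons k phi) i == a i] = [forall i, fiber_card phi i == b i].
  by apply: eq_forallb => i; rewrite fiber_card_cons ab eqn_add2l.
rewrite mulnCA; congr (_ * _)%N; rewrite (bigD1 k) //= [in RHS](bigD1 k) //= mulnA.
congr (_ * _)%N; first by rewrite E /b E eqxx subn1 /= factS.
by apply: eq_bigr => i /negPf; rewrite /b eq_sym => ->; rewrite subn0.
Qed.

Lemma sum_ffun_fibers (R : numFieldType) n (G : ('I_m -> nat) -> R) :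
  (forall a b : 'I_m -> nat, a =1 b -> G a = G b) ->
  (\sum_(phi : {ffun 'I_n -> 'I_m}) G (fiber_card phi)) / n`!%:R
   = \sum_(a : {ffun 'I_m -> 'I_n.+1} | (\sum_i a i == n)%N) G (fun i => a i) / \prod_i
     (a i)`!%:R.
Proof.
move=> Gext.
pose p (phi : {ffun 'I_n -> 'I_m}) : {ffun 'I_m -> 'I_n.+1} :=
  [ffun i => inord (fiber_card phi i)].
have pE phi i : p phi i = fiber_card phi i :> nat.
  rewrite ffunE inordK // ltnS -[leqRHS](sum_fiber_card phi) (bigD1 i) //=.
  exact: leq_addr.
rewrite (partition_big p (fun a : {ffun 'I_m -> 'I_n.+1} => (\sum_i a i == n)%N)) =>
  [|phi _]; last first.
  by rewrite (eq_bigr _ (fun i _ => pE phi i)) sum_fiber_card.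
rewrite mulr_suml; apply: eq_bigr => a /eqP sa.
rewrite (eq_bigr (fun=> G (fun i => a i))) => [|phi /eqP <-]; last by apply: Gext => i;
  rewrite pE.
rewrite sumr_const.
have cardE : (#|[pred phi | p phi == a]| * \prod_i (a i)`! = n`!)%N.
  rewrite -(multinomial_card sa) -big_distrl /= -sum1_card big_mkcond /=; congr (_ * _)%N.
  apply: eq_bigr => phi _; rewrite !inE.
  have -> : (p phi == a) = [forall i, fiber_card phi i == a i]; last by case: forallP.
  apply/eqP/forallP => [<- i|eqa]; first by rewrite pE.
  by apply/ffunP => i; apply: val_inj => /=; rewrite pE; apply/eqP.
rewrite -cardE natrM natr_prod invfM -[X in X * _ = _]mulr_natr -!mulrA; congr (_ * _).
have N0 : #|[pred phi | p phi == a]|%:R != 0 :> R.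
  rewrite pnatr_eq0; apply: contra_eq_neq cardE => ->.
  by rewrite mul0n eq_sym -lt0n fact_gt0.
by rewrite mulrA mulfV ?mul1r.
Qed.

End Multinomial.

Section Transversal.
Variables (R : numFieldType) (n m : nat) (U : 'I_m -> {set 'I_n}) (y : 'I_m -> R).

(** In the Möbius basis the function is concentrated on the sets [U i], apart from the
    empty set, which Hall's condition excludes. *)
Lemma mixed_meets :
  mixed (fun _ : 'I_n => fun A => \sum_i y i * (A :&: U i != set0)%:R)
    = \sum_(phi : {ffun 'I_n -> 'I_m}) (hall (U \o phi))%:R * \prod_j y (phi j).
Proof.
pose c (S : {set 'I_n}) : R := \sum_i y i * (S == U i)%:R.
transitivity (\sum_(S : {ffun 'I_n -> {set 'I_n}}) (hall S)%:R * \prod_j c (S j)).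
  apply: eq_bigr => S _; case: (boolP (hall S)) => [hS|_]; last by rewrite !mul0r.
  congr (_ * _); apply: eq_bigr => j _; rewrite mobius_sum; apply: eq_bigr => i _.
  by rewrite mobius_meet (negPf (hall_neq0 j hS)) subr0.
under eq_bigr do rewrite bigA_distr_bigA mulr_sumr.
rewrite exchange_big /=; apply: eq_bigr => phi _.
rewrite (bigD1 [ffun j => U (phi j)]) //= [X in _ + X]big1 ?addr0 => [|S SU].
  congr (_%:R * _); first by congr (nat_of_bool _); apply: eq_hall => j; rewrite ffunE.
  by apply: eq_bigr => j _; rewrite ffunE eqxx mulr1.
have /existsP[j Sj] : [exists j, S j != U (phi j)].
  rewrite -negb_forall; apply: contraNN SU => /forallP SU; apply/eqP/ffunP => j.
  by rewrite ffunE; apply/eqP.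
by rewrite (bigD1 j) //= (negPf Sj) mulr0 mul0r mulr0.
Qed.

(** Repeating each [U i] as often as [phi] prescribes turns Hall's condition into the
    draconian inequalities: the tightest index sets are full preimages. *)
Lemma hall_fiber_card (phi : {ffun 'I_n -> 'I_m}) :
  hall (U \o phi) = [forall I : {set 'I_m}, (I != set0) ==>
    (\sum_(i in I) fiber_card phi i <= #|\bigcup_(i in I) U i|)%N].
Proof.
have sum_fiber (I : {set 'I_m}) : (\sum_(i in I) fiber_card phi i = #|phi @^-1: I|)%N.
  rewrite exchange_big /= -sum1_card [RHS]big_mkcond; apply: eq_bigr => j _.
  rewrite inE; case: ifPn => jI.
    by rewrite (bigD1 (phi j)) //= eqxx big1 // => i /andP[_ /negPf]; rewrite eq_sym => ->.
  by rewrite big1 // => i iI; case: eqP => // ji; rewrite ji iI in jI.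
apply/forallP/forallP => hU I.
  apply/implyP => _; rewrite sum_fiber; apply: leq_trans (hU _) (subset_leq_card _).
  by apply/bigcupsP => j; rewrite inE; apply: (bigcup_sup (phi j)).
have [->|/set0Pn[j0 j0I]] := eqVneq I set0; first by rewrite cards0.
have /implyP := hU (phi @: I).
have I0 : phi @: I != set0 by apply/set0Pn; exists (phi j0); apply: imset_f.
rewrite sum_fiber => /(_ I0) hI; apply: leq_trans (leq_trans _ hI) (subset_leq_card _).
  by apply/subset_leq_card/subsetP => j jI; rewrite inE imset_f.
by apply/bigcupsP => _ /imsetP[j jI ->]; apply: (bigcup_sup j jI (F := U \o phi)).
Qed.

Lemma prod_fiber_card (phi : {ffun 'I_n -> 'I_m}) :
  \prod_j y (phi j) = \prod_i y i ^+ fiber_card phi i.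
Proof.
rewrite /fiber_card; under [RHS]eq_bigr do rewrite expr_sum.
rewrite exchange_big /=; apply: eq_bigr => j _.
rewrite (bigD1 (phi j)) //= eqxx big1 ?mulr1 // => i /negPf; rewrite eq_sym => ->.
by rewrite expr0.
Qed.

Lemma hall_vol_meets :
  hall_vol (fun A => \sum_i y i * (A :&: U i != set0)%:R)
   = \sum_(a : {ffun 'I_m -> 'I_n.+1} | (\sum_i a i == n)%N &&
        [forall I : {set 'I_m}, (I != set0) ==>
          (\sum_(i in I) a i <= #|\bigcup_(i in I) U i|)%N])
       \prod_i (y i ^+ a i / (a i)`!%:R).
Proof.
pose G (a : 'I_m -> nat) : R := [forall I : {set 'I_m}, (I != set0) ==>
    (\sum_(i in I) a i <= #|\bigcup_(i in I) U i|)%N]%:R * \prod_i y i ^+ a i.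
rewrite /hall_vol mixed_meets.
rewrite (eq_bigr (fun phi => G (fiber_card phi))) => [|phi _]; last first.
  by rewrite /G -hall_fiber_card -prod_fiber_card.
rewrite sum_ffun_fibers => [|a b ab]; last first.
  rewrite /G; congr ((nat_of_bool _)%:R * _); last by apply: eq_bigr => i _; rewrite ab.
  by apply: eq_forallb => I; rewrite (eq_bigr _ (fun i _ => ab i)).
rewrite [RHS]big_mkcondr; apply: eq_bigr => a _; rewrite /G big_split /=.
case: ifP => _; last by rewrite !mul0r.
by rewrite mul1r prodfV.
Qed.

End Transversal.

Section SignVectors.
Variable n : nat.
Implicit Types (tau : {ffun 'I_n -> bool}).

Definition signed_elt tau (j : 'I_n) : pm_index n := if tau j then inl j else inr j.

Definition signed_full tau : {set pm_index n} := [set signed_elt tau j | j : 'I_n].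

Lemma signed_elt_inj tau : injective (signed_elt tau).
Proof. by rewrite /signed_elt => i j; case: (tau i); case: (tau j) => // -[]. Qed.

Lemma in_signed_full_l tau i : (inl i \in signed_full tau) = tau i.
Proof.
apply/imsetP/idP => [[j _]|ti]; last by exists i; rewrite /signed_elt ?ti.
by rewrite /signed_elt; case: ifP => // ? -[->].
Qed.

Lemma in_signed_full_r tau i : (inr i \in signed_full tau) = ~~ tau i.
Proof.
apply/imsetP/idP => [[j _]|/negPf ti]; last by exists i; rewrite /signed_elt ?ti.
by rewrite /signed_elt; case: ifP => // /negbT ? -[->].
Qed.

Lemma card_pm (T : {set pm_index n}) :
  #|T| = (\sum_(i < n) ((inl i \in T) + (inr i \in T)))%N.
Proof.
rewrite -sum1_card big_mkcond big_sumType /= big_split /=.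
by congr (_ + _)%N; apply: eq_bigr => i _; case: (_ \in T).
Qed.

Lemma sum_AdS_max (R : nmodType) (F : {set pm_index n} -> R) : (1 <= n)%N ->
  \sum_(T in AdS_max n) F T = \sum_tau F (signed_full tau).
Proof.
move=> n1.
rewrite (reindex_onto signed_full (fun T => [ffun i => inl i \in T])) /=.
  apply: eq_bigl => tau; apply/andP; split; last first.
    by apply/eqP/ffunP => i; rewrite ffunE in_signed_full_l.
  rewrite !inE card_imset ?card_ord ?eqxx ?andbT; last exact: signed_elt_inj.
  apply/andP; split.
    by apply/set0Pn; exists (signed_elt tau (Ordinal n1)); apply: imset_f.
  apply/forallP => i; rewrite subUset !sub1set in_signed_full_l in_signed_full_r.
  by case: (tau i).
move=> T; rewrite !inE => /andP[/andP[_ /forallP adm] /eqP cT].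
have le1 i : ((inl i \in T) + (inr i \in T) <= 1)%N.
  by have := adm i; rewrite subUset !sub1set; case: (_ \in T); case: (_ \in T).
have eq1 i : ((inl i \in T) + (inr i \in T) = 1)%N.
  have /leqif_sum : forall i, true -> ((inl i \in T) +
    (inr i \in T) <= 1 ?= iff (((inl i \in T) + (inr i \in T))%N == 1))%N.
    by move=> j _; split.
  rewrite -card_pm cT sum1_card card_ord => -[_]; rewrite eqxx.
  by move=> /esym/forallP/(_ i)/eqP.
apply/setP => -[] i; rewrite ?in_signed_full_l ?in_signed_full_r ffunE //.
by have := eq1 i; case: (_ \in T); case: (_ \in T).
Qed.

Lemma hall_vol_draconian (R : numFieldType) m (S : 'I_m -> {set pm_index n}) (y : 'I_m -> R) tau :
  hall_vol (fun A => \sum_i y i * (A :&: [set j | signed_elt tau j \in S i] != set0)%:R)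
   = \sum_(a in draconian S (signed_full tau)) \prod_(i < m) (y i ^+ a i / (a i)`!%:R).
Proof.
rewrite hall_vol_meets; apply: eq_bigl => a; rewrite inE /is_draconian; congr (_ && _).
apply: eq_forallb => I; congr (_ ==> (_ <= _)%N).
rewrite -(card_imset _ (@signed_elt_inj tau)); apply: eq_card => k.
apply/imsetP/bigcupP => [[j /bigcupP[i iI]]|[i iI]].
  by rewrite inE => jS ->; exists i; rewrite // inE jS imset_f.
rewrite inE => /andP[kS /imsetP[j _ kj]]; exists j => //.
by apply/bigcupP; exists i; rewrite // inE -kj.
Qed.

End SignVectors.

From mathcomp Require Import all_classical all_reals all_analysis.
Import numFieldNormedType.Exports.

Local Open Scope classical_set_scope.
Local Open Scope ring_scope.

(** * Truncation and the fundamental theorem of calculus *)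

Section Analysis.
Variable R : realType.

(** A function that agrees to the right and to the left of [t] with polynomials having
    the same first-order expansion is differentiable at [t]. *)
Lemma is_derive_sided (f : R -> R) (p q : {poly R}) (t l : R) :
  p^`().[0] = l -> q^`().[0] = l -> f t = p.[0] -> f t = q.[0] ->
  (\forall h \near 0^'+, f (h + t) = p.[h]) ->
  (\forall h \near 0^'-, f (h + t) = q.[h]) ->
  is_derive t 1 f l.
Proof.
move=> pl ql fp fq near_p near_q.
have slope (r : {poly R}) : r^`().[0] = l ->
    (fun h : R => h^-1 *: (r.[h] - r.[0])) h @[h --> 0^'] --> l.
  move=> <-; have [dr <-] := is_derive_poly r 0.
  apply: cvg_trans (dr); apply: near_eq_cvg; near=> h.
  by rewrite /= scaler1 addr0.
have cf : (fun h : R => h^-1 *: (f (h *: 1 + t) - f t)) h @[h --> 0^'] --> l.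
  apply: (@cvg_at_right_left_dnbhs _ R^o).
  - apply: cvg_trans (cvg_dnbhs_at_right (slope p pl)); apply: near_eq_cvg; near=> h.
    by rewrite scaler1 fp; congr (_ *: (_ - _)); apply/esym; near: h.
  - apply: cvg_trans (cvg_dnbhs_at_left (slope q ql)); apply: near_eq_cvg; near=> h.
    by rewrite scaler1 fq; congr (_ *: (_ - _)); apply/esym; near: h.
apply: DeriveDef; first by apply/cvg_ex; exists l.
exact: cvg_lim cf.
Unshelve. all: by end_near. Qed.

Variable n : nat.

(** The function of the polymatroid with facet heights [f0] (sets without [ord0]) and
    [f1] (sets with [ord0]), cut by the half-space [x_0 <= t]. *)
Definition truncation (f0 f1 : {set 'I_n} -> R) (t : R) : {set 'I_n.+1} -> R := fun A =>
  if ord0 \in A then Num.min (f1 (set_tail A)) (f0 (set_tail A) + t) else f0 (set_tail A).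

(** To the right of [t] the function [truncation f0 f1] moves at unit speed on the sets
    [ord0 |: A] with [t < f1 A - f0 A], to the left on those with
    [t <= f1 A - f0 A].  Both families are closed under taking subsets, and both
    rates are computed by [mixed_truncation], with the same result: hence breakpoints
    do no harm. *)
Lemma is_derive_truncation (f0 f1 : {set 'I_n} -> R) t :
  (forall A B : {set 'I_n}, A \subset B -> f1 B - f0 B <= f1 A - f0 A) ->
  t < f1 finset.set0 - f0 finset.set0 ->
  is_derive t 1 (fun s => hall_vol (truncation f0 f1 s))
    (hall_vol (fun A => Num.min (f0 A) (f1 A - t))).
Proof.
move=> anti t_lt.
pose Dr := [pred A : {set 'I_n} | t < f1 A - f0 A].
pose Dl := [pred A : {set 'I_n} | t <= f1 A - f0 A].
pose g (D : pred {set 'I_n}) (A : {set 'I_n.+1}) : R := ((ord0 \in A) && D (set_tail A))%:R.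
pose f := truncation f0 f1 t.
have slope (D : pred {set 'I_n}) : D finset.set0 ->
    (forall A B : {set 'I_n}, A \subset B -> D B -> D A) ->
    (forall A, D A -> t <= f1 A - f0 A) ->
    (ray_poly f (g D))^`().[0] = hall_vol (fun A => Num.min (f0 A) (f1 A - t)).
  move=> D0 Dsub Dt; rewrite (@ray_poly_truncation _ _ _ _ t) //.
    apply: eq_hall_vol => A; rewrite /f /truncation in_set_cons0 set_tail_cons.
    by case: (lerP (f1 A)); case: (lerP (f0 A)); lra.
  move=> A DA; rewrite /f /truncation !in_set_cons0 !set_tail_cons.
  have := Dt A DA; case: (lerP (f1 A)); lra.
apply: (@is_derive_sided _ (ray_poly f (g Dr)) (ray_poly f (g Dl))).
- apply: slope => //= [A B AB|A]; last exact: ltW.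
  by move=> /lt_le_trans; apply; apply: anti.
- apply: slope => //= [|A B AB]; first exact: ltW.
  by move=> /le_trans; apply; apply: anti.
- by rewrite ray_polyE; apply: eq_hall_vol => A; rewrite mul0r addr0.
- by rewrite ray_polyE; apply: eq_hall_vol => A; rewrite mul0r addr0.
- have small : \forall h \near 0^'+, forall A : {set 'I_n}, t < f1 A - f0 A -> h < f1 A - f0 A - t.
    apply: filter_forall => A; have [tA|_] := ltP t (f1 A - f0 A); last by near=> h => //.
    near=> h => _; near: h; apply: nbhs_right_lt; lra.
  near=> h; rewrite ray_polyE; apply: eq_hall_vol => A.
  have h0 : 0 < h by near: h; exact: nbhs_right_gt.
  have : forall A : {set 'I_n}, t < f1 A - f0 A -> h < f1 A - f0 A - t by near: h.
  move=> /(_ (set_tail A)); rewrite /f /g /truncation /=.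
  case: (ord0 \in A) => /=; last by rewrite mulr0 addr0.
  case: (ltP t) => [tA /(_ isT) hA|tA _].
    by rewrite mulr1 !min_r; lra.
  by rewrite mulr0 !min_l; lra.
- have small : \forall h \near 0^'-, forall A : {set 'I_n}, f1 A - f0 A < t -> f1 A - f0 A - t < h.
    apply: filter_forall => A; have [tA|_] := ltP (f1 A - f0 A) t; last by near=> h => //.
    near=> h => _; near: h; apply: nbhs_left_gt; lra.
  near=> h; rewrite ray_polyE; apply: eq_hall_vol => A.
  have h0 : h < 0 by near: h; exact: nbhs_left_lt.
  have : forall A : {set 'I_n}, f1 A - f0 A < t -> f1 A - f0 A - t < h by near: h.
  move=> /(_ (set_tail A)); rewrite /f /g /truncation /=.
  case: (ord0 \in A) => /=; last by rewrite mulr0 addr0.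
  case: (leP t) => [tA _|tA /(_ isT) hA].
    by rewrite mulr1 !min_r; lra.
  by rewrite mulr0 !min_l; lra.
Unshelve. all: by end_near. Qed.

Lemma continuous_hall_vol m (f : R -> {set 'I_m} -> R) :
  (forall A, continuous (f ^~ A)) -> continuous (fun t => hall_vol (f t)).
Proof.
move=> cf; rewrite /hall_vol /mixed => t.
apply: cvgMr_tmp; move: t; apply: (@continuous_big R^o) => [|S _]; first exact: add_continuous.
move=> t; apply: cvgMl_tmp; move: t.
apply: (@continuous_big R^o) => [|j _]; first exact: mul_continuous.
rewrite /mobius; apply: (@continuous_big R^o) => [|A _]; first exact: add_continuous.
by move=> t; apply: cvgMl_tmp; apply: cf.
Qed.

Lemma continuous_truncation (f0 f1 : {set 'I_n} -> R) A : continuous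
  (fun t => truncation f0 f1 t A).
Proof.
rewrite /truncation; case: (ord0 \in A) => t; last exact: cvg_cst.
apply: (@continuous_min _ _ (fun=> f1 (set_tail A)) (fun t => f0 (set_tail A) + t));
  first exact: cvg_cst.
by apply: cvgD; [exact: cvg_cst|exact: cvg_id].
Qed.

End Analysis.

Section LowTruncation.
Variable R : realType.

(** Both sides have the same derivative in [t] and vanish at [0]. *)
Lemma hall_vol_lift_fun n (k : {set 'I_n} -> R) t : hall_vol (lift_fun k t) = t * hall_vol k.
Proof.
pose phi s := hall_vol (lift_fun k s) - s * hall_vol k.
have phi0 : phi 0 = 0.
  rewrite /phi mul0r subr0 /hall_vol /mixed big1 ?mul0r // => S _.
  have [/existsP[j Sj]|] := boolP [exists j, ord0 \in S j].
    by rewrite (bigD1 j) //= mobius_lift_fun Sj mul0r mul0r mulr0.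
  rewrite negb_exists => /forallP S0.
  by rewrite hall_no_head // mul0r.
have dphi (s : R) : is_derive s (1 : R) phi 0.
  have dl : is_derive s (1 : R) (fun s => hall_vol (lift_fun k s)) (hall_vol k).
    pose p := ray_poly (lift_fun k s) (fun A : {set 'I_n.+1} => ((ord0 \in A) && predT
      (set_tail A))%:R).
    have pE h : hall_vol (lift_fun k (h + s)) = p.[h].
      by rewrite ray_polyE; apply: eq_hall_vol => A; rewrite /lift_fun andbT; ring.
    have p0 : p^`().[0] = hall_vol k.
      rewrite (@ray_poly_truncation _ _ _ _ s) //.
        by apply: eq_hall_vol => A; rewrite /lift_fun set_tail_cons in_set_cons0 mulr1 addrK.
      by move=> A _; rewrite /lift_fun !set_tail_cons !in_set_cons0 mulr1 mulr0 addr0.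
    apply: (@is_derive_sided _ _ p p) => //; try by rewrite -pE add0r.
    - by near=> h; exact: pE.
    - by near=> h; exact: pE.
  have dm : is_derive s (1 : R) (fun s => s * hall_vol k) (hall_vol k).
    have -> : (fun s => s * hall_vol k) = horner ((hall_vol k) *: 'X).
      by apply/funext => z; rewrite hornerZ hornerX mulrC.
    by have := is_derive_poly (hall_vol k *: 'X) s; rewrite derivZ derivX hornerZ hornerC mulr1.
  rewrite -[0](subrr (hall_vol k)); exact: is_deriveB.
have := is_derive_0_is_cst t 0 dphi.
by rewrite phi0 /phi => /eqP; rewrite subr_eq0 => /eqP.
Unshelve. all: by end_near. Qed.

(** Below all breakpoints only the cut [x_0 <= t] bounds the coordinate of [ord0], so
    that the function is the one of a prism over the polymatroid of [f0]. *)
Lemma hall_vol_truncation_low n (f0 f1 : {set 'I_n} -> R) t :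
  (forall A, f0 A + t <= f1 A) -> hall_vol (truncation f0 f1 t) = t * hall_vol f0.
Proof.
move=> low; rewrite -hall_vol_lift_fun; apply: eq_hall_vol => A.
rewrite /truncation /lift_fun; case: ifP => _; last by rewrite mulr0 addr0.
by rewrite mulr1 min_r.
Qed.

End LowTruncation.

Section OneOrthantPair.
Variables (R : realType) (n : nat) (f0 f1 f2 : {set 'I_n} -> R).
Hypothesis anti1 : forall A B : {set 'I_n}, A \subset B -> f1 B - f0 B <= f1 A - f0 A.
Hypothesis anti2 : forall A B : {set 'I_n}, A \subset B -> f2 B - f0 B <= f2 A - f0 A.
Hypothesis opp12 : forall A B : {set 'I_n}, (A \subset B) || (B \subset A) ->
  f0 A + f0 B <= f1 A + f2 B.

Definition two_sided t : {set 'I_n} -> R := fun A =>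
  Num.min (f0 A) (Num.min (f1 A - t) (f2 A + t)).

(** The sets where the upper and the lower cut are active are mutually incomparable. *)
Lemma hall_vol_two_sided t : hall_vol (two_sided t) =
  hall_vol (fun A => Num.min (f0 A) (f1 A - t)) + hall_vol (fun A => Num.min (f0 A) (f2 A +
    t)) - hall_vol f0.
Proof.
pose u A := Num.min (f0 A) (f1 A - t) - f0 A.
pose v A := Num.min (f0 A) (f2 A + t) - f0 A.
have u0 A : u A != 0 -> f1 A - t < f0 A.
  by rewrite /u; case: (lerP (f0 A)) => //; rewrite subrr eqxx.
have v0 A : v A != 0 -> f2 A + t < f0 A.
  by rewrite /v; case: (lerP (f0 A)) => //; rewrite subrr eqxx.
have inc A B : u A != 0 -> v B != 0 -> incomparable A B.
  move=> /u0 uA /v0 vB; rewrite /incomparable -negb_or; apply/negP => /opp12.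
  lra.
have := hall_vol_incomparable f0 inc.
rewrite (@eq_hall_vol _ _ _ (two_sided t)) => [|A]; last first.
  have := @opp12 A A; rewrite subxx => /(_ isT); rewrite /u /v /two_sided.
  case: (lerP (f1 A - t) (f2 A + t)) => ?; case: (lerP (f0 A) (f1 A - t)) => ?;
    case: (lerP (f0 A) (f2 A + t)) => ? ?; rewrite ?min_l ?min_r; lra.
rewrite (@eq_hall_vol _ _ (fun A => f0 A + u A) (fun A => Num.min (f0 A) (f1 A - t))) =>
  [|A]; last by rewrite /u addrC subrK.
rewrite (@eq_hall_vol _ _ (fun A => f0 A + v A) (fun A => Num.min (f0 A) (f2 A + t))) =>
  [|A]; last by rewrite /v addrC subrK.
by move=> <-; rewrite addrK.
Qed.

(** A primitive of [t |-> hall_vol (two_sided t)]: [f1] bounds the coordinate from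
    above and [f2] from below, and the linear term
    corrects the double counting of [f0] in [hall_vol_two_sided]. *)
Definition primitive t :=
  hall_vol (truncation f0 f1 t) - hall_vol (truncation f0 f2 (- t)) - t * hall_vol f0.

Let s0 : {set 'I_n} := finset.set0.

Lemma is_derive_primitive t : f0 s0 - f2 s0 < t < f1 s0 - f0 s0 ->
  is_derive t (1 : R) primitive (hall_vol (two_sided t)).
Proof.
move=> /andP[t2 t1].
have d1 := is_derive_truncation anti1 t1.
have t2' : - t < f2 s0 - f0 s0 by lra.
have d2 := is_derive_truncation anti2 t2'.
have dN : is_derive t (1 : R) (fun s : R => - s) (-1) by apply: is_deriveN.
have d2' : is_derive t (1 : R) (fun s => hall_vol (truncation f0 f2 (- s)))
    (- hall_vol (fun A => Num.min (f0 A) (f2 A + t))).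
  have := @is_derive1_comp _ _ _ t _ _ d2 dN.
  rewrite mulrN1 (_ : (fun A => _) = (fun A => Num.min (f0 A) (f2 A + t))) //.
  by apply/funext => A; rewrite opprK.
have dm : is_derive t (1 : R) (fun s => s * hall_vol f0) (hall_vol f0).
  have -> : (fun s => s * hall_vol f0) = horner ((hall_vol f0) *: 'X).
    by apply/funext => z; rewrite hornerZ hornerX mulrC.
  by have := is_derive_poly (hall_vol f0 *: 'X) t; rewrite derivZ derivX hornerZ hornerC mulr1.
rewrite hall_vol_two_sided -[X in _ + X - _]opprK.
exact: is_deriveB (is_deriveB _ _) _.
Qed.

Lemma continuous_primitive : continuous primitive.
Proof.
move=> t; apply: cvgB; first apply: cvgB.
- by apply: continuous_hall_vol => A; apply: continuous_truncation.
- apply: (@continuous_comp _ _ _ (fun s : R => - s) (fun s => hall_vol (truncation f0 f2 s))).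
    exact: cvgN.
  by apply: continuous_hall_vol => A; apply: continuous_truncation.
- by apply: cvgMr_tmp; exact: cvg_id.
Qed.

Lemma continuous_hall_vol_two_sided : continuous (fun t => hall_vol (two_sided t)).
Proof.
apply: continuous_hall_vol => A t; rewrite /two_sided.
apply: (@continuous_min _ _ (fun=> f0 A) (fun t => Num.min (f1 A - t) (f2 A + t)));
  first exact: cvg_cst.
apply: (@continuous_min _ _ (fun t => f1 A - t) (fun t => f2 A + t)).
  by apply: cvgB; [exact: cvg_cst|exact: cvg_id].
by apply: cvgD; [exact: cvg_cst|exact: cvg_id].
Qed.

(** At the upper end the first truncation is complete, and the second one is so low
    that it cancels the linear term; the lower end is symmetric. *)
Lemma primitive_sub :
  primitive (f1 s0 - f0 s0) - primitive (f0 s0 - f2 s0)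
   = hall_vol (fun A => if ord0 \in A then f1 (set_tail A) else f0 (set_tail A))
     + hall_vol (fun A => if ord0 \in A then f2 (set_tail A) else f0 (set_tail A)).
Proof.
rewrite /primitive !opprB.
rewrite (@hall_vol_truncation_low _ _ f0 f2 (f0 s0 - f1 s0)); last first.
  by move=> A; have := @opp12 s0 A; rewrite finset.sub0set => /(_ isT); lra.
rewrite (@hall_vol_truncation_low _ _ f0 f1 (f0 s0 - f2 s0)); last first.
  by move=> A; have := @opp12 A s0; rewrite finset.sub0set orbT => /(_ isT); lra.
rewrite (@eq_hall_vol _ _ (truncation f0 f1 _) (fun A => if ord0 \in A then f1
  (set_tail A) else f0 (set_tail A))) => [|A]; last first.
  rewrite /truncation; case: ifP => // _; apply: min_l.
  by have := anti1 (finset.sub0set (set_tail A)); rewrite -/s0; lra.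
rewrite (@eq_hall_vol _ _ (truncation f0 f2 _) (fun A => if ord0 \in A then f2
  (set_tail A) else f0 (set_tail A))) => [|A]; last first.
  rewrite /truncation; case: ifP => // _; apply: min_l.
  by have := anti2 (finset.sub0set (set_tail A)); rewrite -/s0; lra.
ring.
Qed.

End OneOrthantPair.

(** * Volumes of bisubmodular polytopes *)

Notation signed_set n := {ffun 'I_n -> option bool}.

Definition smeet (a b : option bool) := if a == b then a else None.
Definition sjoin (a b : option bool) :=
  match a, b with
  | None, _ => b
  | _, None => a
  | Some x, Some y => if x == y then a else None
  end.

Section SignedSets.
Variable R : realType.

Definition sgn_val (a : option bool) : R :=
  match a with Some true => 1 | Some false => -1 | None => 0 end.

Lemma sgn_valD a b : sgn_val (smeet a b) + sgn_val (sjoin a b) = sgn_val a + sgn_val b.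
Proof. by move: a b => [[]|] [[]|]; rewrite /= ?addr0 ?add0r ?subrr ?addNr. Qed.

Section Dim.
Variable n : nat.
Implicit Types (A B : signed_set n) (x : 'rV[R]_n).

Definition meets A B : signed_set n := [ffun i => smeet (A i) (B i)].
(** Union of signed sets in which opposite signs cancel; with this convention the
    vectors of [meets A B] and [joins A B] add up to those of [A] and [B]. *)
Definition joins A B : signed_set n := [ffun i => sjoin (A i) (B i)].

Definition spair A x : R := \sum_i sgn_val (A i) * x 0 i.

Definition bisubmodular (f : signed_set n -> R) :=
  forall A B, f (meets A B) + f (joins A B) <= f A + f B.

Definition bisub_polytope (f : signed_set n -> R) : set 'rV[R]_n :=
  [set x | forall A, spair A x <= f A].

Definition sempty : signed_set n := [ffun=> None].

Lemma spair_sempty x : spair sempty x = 0.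
Proof. by rewrite /spair big1 // => i _; rewrite ffunE mul0r. Qed.

(** The subsets of the orthant of the sign vector [T]. *)
Definition signing (T : {ffun 'I_n -> bool}) (A : {set 'I_n}) : signed_set n :=
  [ffun i => if i \in A then Some (T i) else None].

Lemma signing0 T : signing T finset.set0 = sempty.
Proof. by apply/ffunP => i; rewrite !ffunE finset.in_set0. Qed.

Lemma meets_signing T (A B : {set 'I_n}) : A \subset B -> meets (signing T A)
  (signing T B) = signing T A.
Proof.
move=> /fintype.subsetP AB; apply/ffunP => i; rewrite !ffunE /smeet.
by have := AB i; case: (i \in A) => [/(_ isT) ->|_]; [rewrite eqxx | case: ifP].
Qed.

Lemma joins_signing T (A B : {set 'I_n}) : A \subset B -> joins (signing T A)
  (signing T B) = signing T B.
Proof.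
move=> /fintype.subsetP AB; apply/ffunP => i; rewrite !ffunE.
by have := AB i; case: (i \in A) => [/(_ isT) ->|_] //=; rewrite eqxx.
Qed.

Lemma meetsC A B : meets A B = meets B A.
Proof. by apply/ffunP => i; rewrite !ffunE; move: (A i) (B i) => [[]|] [[]|]. Qed.

Lemma joinsC A B : joins A B = joins B A.
Proof. by apply/ffunP => i; rewrite !ffunE; move: (A i) (B i) => [[]|] [[]|]. Qed.

End Dim.

Lemma meets_ffun_cons n a b (A B : signed_set n) :
  meets (ffun_cons a A) (ffun_cons b B) = ffun_cons (smeet a b) (meets A B).
Proof.
by apply/ffunP => i; rewrite [LHS]ffunE; case: (unliftP ord0 i) => [j|] ->;
  rewrite ?ffun_cons0 ?ffun_consS // ffunE.
Qed.

Lemma joins_ffun_cons n a b (A B : signed_set n) :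
  joins (ffun_cons a A) (ffun_cons b B) = ffun_cons (sjoin a b) (joins A B).
Proof.
by apply/ffunP => i; rewrite [LHS]ffunE; case: (unliftP ord0 i) => [j|] ->;
  rewrite ?ffun_cons0 ?ffun_consS // ffunE.
Qed.

Lemma signing_set_cons n b c (T : {ffun 'I_n -> bool}) (A : {set 'I_n}) :
  signing (ffun_cons b T) (set_cons c A) = ffun_cons (if c then Some b else None) (signing T A).
Proof.
apply/ffunP => i; rewrite [LHS]ffunE; case: (unliftP ord0 i) => [j|] ->.
  by rewrite !ffun_consS in_set_consS ffunE.
by rewrite !ffun_cons0 in_set_cons0.
Qed.

Lemma spair_ffun_cons n a (A : signed_set n) (t : R) (x : 'rV[R]_n) :
  spair (ffun_cons a A) (row_mx t%:M x : 'rV[R]_n.+1) = sgn_val a * t + spair A x.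
Proof.
rewrite /spair big_ord_recl ffun_cons0; congr (_ * _ + _).
  by rewrite mxE; case: splitP => // k _; rewrite mxE !ord1 mulr1n.
apply: eq_bigr => j _; rewrite ffun_consS mxE; case: splitP => [k|k /= []];
  first by rewrite [k]ord1.
by move=> /val_inj ->.
Qed.

Section Slice.
Variables (n : nat) (f : signed_set n.+1 -> R).

Definition slice (t : R) (A : signed_set n) : R :=
  Num.min (f (ffun_cons None A))
    (Num.min (f (ffun_cons (Some true) A) - t) (f (ffun_cons (Some false) A) + t)).

Lemma slice_le t A a : slice t A <= f (ffun_cons a A) - sgn_val a * t.
Proof.
rewrite /slice; case: a => [[]|] /=;
  rewrite ?mul1r ?mulN1r ?opprK ?mul0r ?subr0 !ge_min lexx ?orbT //.
Qed.

Lemma slice_attained t A : exists a, slice t A = f (ffun_cons a A) - sgn_val a * t.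
Proof.
rewrite /slice; case: (lerP (f (ffun_cons (Some true) A) - t)) => _.
  case: (lerP (f (ffun_cons None A))) => _; first by exists None; rewrite mul0r subr0.
  by exists (Some true); rewrite mul1r.
case: (lerP (f (ffun_cons None A))) => _; first by exists None; rewrite mul0r subr0.
by exists (Some false); rewrite mulN1r opprK.
Qed.

Lemma slice_polytope t :
  [set x : 'rV[R]_n | bisub_polytope f (row_mx t%:M x : 'rV[R]_n.+1)] = bisub_polytope (slice t).
Proof.
apply/seteqP; split => x /= fx A.
  have [a ->] := slice_attained t A.
  by rewrite lerBrDr addrC -spair_ffun_cons; apply: fx.
rewrite -[A]ffun_cons_eta spair_ffun_cons addrC -lerBrDr.
exact: le_trans (fx _) (slice_le _ _ _).
Qed.

Hypothesis fb : bisubmodular f.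

(** The minimum is over the value of the first coordinate, and these values can be
    intersected and joined together with the sets. *)
Lemma slice_bisubmodular t : bisubmodular (slice t).
Proof.
move=> A B.
have [a ->] := slice_attained t A; have [b ->] := slice_attained t B.
have := slice_le t (meets A B) (smeet a b).
have := slice_le t (joins A B) (sjoin a b).
have := fb (ffun_cons a A) (ffun_cons b B); rewrite meets_ffun_cons joins_ffun_cons.
have : (sgn_val (smeet a b) + sgn_val (sjoin a b)) * t = (sgn_val a + sgn_val b) * t.
  by rewrite sgn_valD.
lra.
Qed.

Variable T : {ffun 'I_n -> bool}.
Let g a := fun A : {set 'I_n} => f (ffun_cons a (signing T A)).

(** The breakpoints of the slices are monotone along a chain. *)
Lemma anti_signing a (A B : {set 'I_n}) : A \subset B ->
  g a B - g None B <= g a A - g None A.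
Proof.
move=> AB; have := fb (ffun_cons a (signing T A)) (ffun_cons None (signing T B)).
rewrite meets_ffun_cons joins_ffun_cons meets_signing // joins_signing // /g.
have -> : smeet a None = None by case: a => [[]|].
have -> : sjoin a None = a by case: a => [[]|].
lra.
Qed.

(** Along a chain the breakpoints from below precede those from above. *)
Lemma opp_signing (A B : {set 'I_n}) : (A \subset B) || (B \subset A) ->
  g None A + g None B <= g (Some true) A + g (Some false) B.
Proof.
have := fb (ffun_cons (Some true) (signing T A)) (ffun_cons (Some false) (signing T B)).
rewrite meets_ffun_cons joins_ffun_cons /g => H /orP[] AB; move: H.
  by rewrite meets_signing // joins_signing.
by rewrite meetsC joinsC meets_signing // joins_signing //= [X in X <= _]addrC.
Qed.

End Slice.

Lemma is_derive_bigsum (I : Type) (r : seq I) (F : I -> R -> R) (d : I -> R) (t : R) :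
  (forall i, is_derive t (1 : R) (F i) (d i)) ->
  is_derive t (1 : R) (fun s => \sum_(i <- r) F i s) (\sum_(i <- r) d i).
Proof.
move=> dF; elim: r => [|i r IH].
  rewrite big_nil (_ : (fun s => _) = cst 0); first exact: is_derive_cst.
  by apply/funext => s; rewrite big_nil.
rewrite big_cons (_ : (fun s => _) = F i + (fun s => \sum_(j <- r) F j s)).
  exact: is_deriveD.
by apply/funext => s; rewrite big_cons.
Qed.

Lemma vol_set0 n : vol (set0 : set 'rV[R]_n) = 0%E.
Proof.
elim: n => [|n IH] /=; first by rewrite indic0.
apply: integral0_eq => t _.
by rewrite (_ : [set x | _] = set0).
Qed.

(** Slice by the first coordinate: the slices are polytopes of the same kind, and the
    induction hypothesis makes their volume the sum over sign vectors of functions of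
    [t] whose primitives are known. *)
Theorem vol_bisubmodular n (f : signed_set n -> R) :
  bisubmodular f -> f (sempty n) = 0 ->
  vol (bisub_polytope f)
    = (\sum_(T : {ffun 'I_n -> bool}) hall_vol (fun A => f (signing T A)))%:E.
Proof.
elim: n f => [|n IH] f fb f0.
  rewrite /= indicE mem_set => [|A] /=; last first.
    by rewrite /spair big_ord0 (_ : A = sempty 0) ?f0 //; apply/ffunP => -[].
  rewrite (eq_bigr (fun=> 1)) => [|T _]; last by rewrite hall_vol_dim0.
  by rewrite sumr_const card_ffun card_bool card_ord.
pose g T a := fun A : {set 'I_n} => f (ffun_cons a (signing T A)).
pose F1 := f (ffun_cons (Some true) (sempty n)).
pose F2 := f (ffun_cons (Some false) (sempty n)).
have fN : f (ffun_cons None (sempty n)) = 0.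
  rewrite -f0; congr f; apply/ffunP => i; rewrite ffunE [RHS]ffunE.
  by case: unlift => // j; rewrite ffunE.
have F12 : - F2 <= F1.
  have := fb (ffun_cons (Some true) (sempty n)) (ffun_cons (Some false) (sempty n)).
  rewrite meets_ffun_cons joins_ffun_cons /= -/F1 -/F2.
  have -> : meets (sempty n) (sempty n) = sempty n by apply/ffunP => i; rewrite !ffunE.
  have -> : joins (sempty n) (sempty n) = sempty n by apply/ffunP => i; rewrite !ffunE.
  rewrite fN; lra.
pose h t : R := \sum_(T : {ffun 'I_n -> bool}) hall_vol (two_sided (g T None) (g T
  (Some true)) (g T (Some false)) t).
pose H t : R := \sum_(T : {ffun 'I_n -> bool}) primitive (g T None) (g T (Some true)) (g T
  (Some false)) t.
have -> : vol (bisub_polytope f) = (\int[lebesgue_measure]_(t in `[(- F2)%R, F1]) (h t)%:E)%E.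
  rewrite [RHS]integral_mkcond /=; apply: eq_integral => t _.
  rewrite slice_polytope /patch; case: ifPn => tF.
    rewrite IH //; first exact: slice_bisubmodular.
    rewrite /slice fN -/F1 -/F2 min_l // le_min.
    move: tF; rewrite inE /= in_itv /= => /andP[]; lra.
  rewrite (_ : bisub_polytope _ = set0) ?vol_set0 //.
  apply/seteqP; split => // x /(_ (sempty n)); rewrite spair_sempty /slice fN -/F1 -/F2.
  rewrite !le_min lexx /= => /andP[t1 t2]; move/negP: tF; apply.
  by rewrite inE /= in_itv /=; apply/andP; split; lra.
have gN T : g T None finset.set0 = 0 by rewrite /g signing0.
have g1 T : g T (Some true) finset.set0 = F1 by rewrite /g signing0.
have g2 T : g T (Some false) finset.set0 = F2 by rewrite /g signing0.
have HE : H F1 - H (- F2) = \sum_(T : {ffun 'I_n.+1 -> bool}) hall_vol (fun A => f (signing T A)).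
  rewrite big_ffun_cons big_bool /= -big_split -sumrB /=; apply: eq_bigr => T _.
  have := @primitive_sub _ _ (g T None) (g T (Some true)) (g T (Some false))
    (anti_signing fb T (Some true)) (anti_signing fb T (Some false)) (opp_signing fb T).
  rewrite gN g1 g2 subr0 sub0r => ->.
  by congr (_ + _); apply: eq_hall_vol => A;
    rewrite -[A in RHS]set_cons_eta signing_set_cons; case: (ord0 \in A).
rewrite -HE.
move: F12; rewrite le_eqVlt => /predU1P[<-|F12].
  by rewrite subrr set_itv1 integral_set1.
(* Each sign vector of the slice contributes one primitive. *)
have dH t : t \in `]- F2, F1[%R -> is_derive t (1 : R) H (h t).
  move=> /[!in_itv] /= tF; apply: is_derive_bigsum => T; apply: is_derive_primitive.
  - exact: (anti_signing fb T (Some true)).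
  - exact: (anti_signing fb T (Some false)).
  - exact: (opp_signing fb T).
  - by rewrite gN g1 g2 subr0 sub0r.
rewrite (@continuous_FTC2 _ h H) ?EFinB //.
- apply: continuous_subspaceT; apply: continuous_big => [|T _]; first exact: add_continuous.
  exact: continuous_hall_vol_two_sided.
- have cH : continuous H.
    apply: continuous_big => [|T _]; first exact: add_continuous.
    exact: continuous_primitive.
  split=> [t tF| |]; [|exact: cvg_at_right_filter (cH _)|exact: cvg_at_left_filter (cH _)].
  by have [] := dH t tF.
- by move=> t tF; rewrite derive1E; have [_ ->] := dH t tF.
Qed.

End SignedSets.

(** * Separation of a point from a polytope *)

Section Separation.
Variables (R : realType) (n : nat).
Local Notation V := 'rV[R]_n.
Implicit Types (u v w c x : V) (K : set V).

Lemma dotDr c u v : dot c (u + v) = dot c u + dot c v.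
Proof. by rewrite /dot -big_split; apply: eq_bigr => i _; rewrite mxE mulrDr. Qed.

Lemma dotZr c t u : dot c (t *: u) = t * dot c u.
Proof. by rewrite /dot mulr_sumr; apply: eq_bigr => i _; rewrite mxE mulrCA. Qed.

Lemma dotC u v : dot u v = dot v u.
Proof. by apply: eq_bigr => i _; rewrite mulrC. Qed.

Lemma dotDl u v c : dot (u + v) c = dot u c + dot v c.
Proof. by rewrite dotC dotDr !(dotC c). Qed.

Lemma dotZl t u c : dot (t *: u) c = t * dot u c.
Proof. by rewrite dotC dotZr dotC. Qed.

Lemma dotNr c u : dot c (- u) = - dot c u.
Proof. by rewrite -scaleN1r dotZr mulN1r. Qed.

Lemma dotNl u c : dot (- u) c = - dot u c.
Proof. by rewrite dotC dotNr dotC. Qed.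

Lemma dot0r c : dot c 0 = 0.
Proof. by rewrite -(scale0r 0) dotZr mul0r. Qed.

Lemma dot_subZ c u t : dot (c - t *: u) (c - t *: u)
  = dot c c - 2 * t * dot c u + t * t * dot u u.
Proof. rewrite !(dotDl, dotDr, dotNl, dotNr, dotZl, dotZr) (dotC u c); ring. Qed.

Lemma dot_ge0 u : 0 <= dot u u.
Proof. by apply: sumr_ge0 => i _; rewrite -expr2 sqr_ge0. Qed.

Lemma dot_gt0 u : u != 0 -> 0 < dot u u.
Proof.
move=> u0; rewrite lt_neqAle dot_ge0 andbT eq_sym.
apply: contra u0 => /eqP uu; apply/eqP/rowP => i; rewrite mxE.
have sq_ge0 (j : 'I_n) : true -> 0 <= u 0 j * u 0 j by rewrite -expr2 sqr_ge0.
have E : u 0 i * u 0 i = 0 by apply: (psumr_eq0P sq_ge0 uu).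
by apply/eqP; rewrite -[_ == _]orbb -mulf_eq0 E.
Qed.

Definition convex K := forall x y (t : R), 0 <= t -> t <= 1 -> K x -> K y ->
  K (t *: x + (1 - t) *: y).

Lemma convex_setE K : @convex_set R V K <-> convex K.
Proof.
split=> [cK x y t t0 t1 Kx Ky|cK x y t].
  by have := cK x y (Itv01 t0 t1) (mem_set Kx) (mem_set Ky); rewrite inE.
by rewrite !inE => Kx Ky; apply: cK.
Qed.

(** The cone over [K] with apex [a]. *)
Definition join_point a K : set V :=
  [set z | exists t p, [/\ 0 <= t, t <= 1, K p & z = t *: a + (1 - t) *: p]].

Lemma compact_join_point a K : compact K -> compact (join_point a K).
Proof.
move=> cK.
pose g (z : R * V) : V := z.1 *: a + (1 - z.1) *: z.2.
have -> : join_point a K = g @` (`[0, 1] `*` K).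
  apply/seteqP; split => [z [t [p [t0 t1 Kp ->]]]|_ [[t p] /= [+ Kp] <-]].
    by exists (t, p) => //=; split; rewrite //= in_itv /= t0 t1.
  by rewrite in_itv /= => /andP[t0 t1]; exists t, p.
apply: continuous_compact; last exact: compact_setX (@segment_compact _ _ _) cK.
apply: continuous_subspaceT => -[t p]; rewrite /g.
apply: cvgD.
  by apply: cvgZl; exact: cvg_fst.
apply: cvgZ; last exact: cvg_snd.
by apply: cvgB; [exact: cvg_cst|exact: cvg_fst].
Qed.

Lemma convex_join_point a K : convex K -> convex (join_point a K).
Proof.
move=> cK _ _ l l0 l1 [t [p [t0 t1 Kp ->]]] [t' [p' [t'0 t'1 Kp' ->]]].
pose tau := l * t + (1 - l) * t'.
have tau0 : 0 <= tau by rewrite /tau; nra.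
have tau1 : tau <= 1 by rewrite /tau; nra.
have m1 : 0 <= l * (1 - t) by rewrite mulr_ge0 // subr_ge0.
have m2 : 0 <= (1 - l) * (1 - t') by rewrite mulr_ge0 // subr_ge0.
have [E|tauN] := eqVneq tau 1.
  have e1 : l * (1 - t) = 0 by move: E; rewrite /tau; lra.
  have e2 : (1 - l) * (1 - t') = 0 by move: E; rewrite /tau; lra.
  exists 1, p; split => //; rewrite subrr scale0r addr0 scale1r.
  rewrite !scalerDr !scalerA e1 e2 !scale0r !addr0 -scalerDl.
  by rewrite -/tau E scale1r.
exists tau, ((l * (1 - t) / (1 - tau)) *: p + (1 - l * (1 - t) / (1 - tau)) *: p').
have d0 : 0 < 1 - tau by rewrite subr_gt0 lt_neqAle tauN.
split => //.
  apply: cK => //; first by rewrite divr_ge0 // ltW.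
  by rewrite ler_pdivrMr // mul1r /tau; lra.
rewrite !scalerDr !scalerA addrACA -scalerDl -/tau; congr (_ + (_ + _)).
  by congr (_ *: _); field; rewrite gt_eqF.
congr (_ *: _); rewrite [RHS]mulrBr mulr1 [in RHS]mulrCA divff ?gt_eqF // mulr1 /tau; ring.
Qed.

(** Adding the points one by one as apexes of cones keeps the hull compact. *)
Lemma conv_hull_seq (s : seq V) a : exists K,
  [/\ compact K, convex K, K a, (forall z, z \in s -> K z)
    & forall C, convex C -> C a -> (forall z, z \in s -> C z) -> K `<=` C].
Proof.
elim: s a => [|b s IH] a.
  exists [set a]; split => //; first exact: compact_set1.
  - by move=> x y t _ _ -> ->; rewrite -scalerDl addrC subrK scale1r.
  - by move=> C _ Ca _ _ ->.
have [K [cK vK Ka sK mK]] := IH a.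
exists (join_point b K); split.
- exact: compact_join_point.
- exact: convex_join_point.
- by exists 0, a; split; rewrite // scale0r add0r subr0 scale1r.
- move=> z; rewrite in_cons => /predU1P[->|zs].
    by exists 1, a; split; rewrite // subrr scale0r addr0 scale1r.
  by exists 0, z; split; rewrite ?scale0r ?add0r ?subr0 ?scale1r //; apply: sK.
move=> C vC Ca sC _ [t [p [t0 t1 Kp ->]]]; apply: (vC) => //.
  by apply: sC; rewrite mem_head.
by apply: (mK C vC Ca _ p Kp) => z zs; apply: sC; rewrite in_cons zs orbT.
Qed.

Lemma polytope_compact_convex P : is_polytope P -> [/\ compact P, convex P & P !=set0].
Proof.
move=> [A [/finite_seqP[s As] [a Aa] ->]].
have [K [cK vK Ka sK mK]] := conv_hull_seq s a.
have -> : conv_hull A = K; last by split => //; exists a.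
apply/seteqP; split.
  apply: smallest_sub; first exact/convex_setE.
  by rewrite As => z /= zs; apply: sK.
move=> z Kz C /= [/convex_setE vC AC]; apply: (mK C vC (AC _ Aa) _ z Kz).
by move=> w ws; apply: AC; rewrite As.
Qed.

(** The nearest point [p0] of [P] gives the normal vector [x - p0]: moving from [p0]
    towards another point of [P] cannot decrease the distance to [x]. *)
Lemma separation P x : is_polytope P -> ~ P x ->
  exists c, forall p, P p -> dot c p < dot c x.
Proof.
move=> /polytope_compact_convex[cP vP P0] Px.
have cont : {within P, continuous (fun p : V => dot (x - p) (x - p))}.
  have -> : (fun p : V => dot (x - p) (x - p))
      = (fun p => \sum_(i < n) (x 0 i - p 0 i) * (x 0 i - p 0 i)).
    by apply/funext => p; apply: eq_bigr => i _; rewrite !mxE.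
  apply: continuous_subspaceT.
  apply: (@continuous_big R^o) => [|i _]; first exact: add_continuous.
  have ci : continuous (fun p : V => (x 0 i - p 0 i : R^o)).
    move=> p; apply: continuousB; first exact: cst_continuous.
    exact: coord_continuous.
  by move=> p; apply: (@continuousM R _ (fun p : V => x 0 i - p 0 i)
    (fun p : V => x 0 i - p 0 i) p); apply: ci.
have [p0 Pp0 min_p0] := EVT_min_rV P0 cP cont.
rewrite inE in Pp0; exists (x - p0) => p Pp.
have xp0 : x - p0 != 0 by apply: contra_notN Px; rewrite subr_eq0 => /eqP ->.
set c := x - p0; set d := p - p0.
(* Comparison of p0 with the point of P at parameter s towards p. *)
have ineq (s : R) : 0 <= s -> s <= 1 -> 2 * dot c d <= s * dot d d \/ s = 0.
  move=> s0 s1; have Ps : P (s *: p + (1 - s) *: p0) by apply: vP.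
  have := min_p0 _ (mem_set Ps).
  have -> : x - (s *: p + (1 - s) *: p0) = c - s *: d.
    by rewrite /c /d scalerBr scalerBl scale1r; apply/rowP => i; rewrite !mxE; ring.
  rewrite -/c dot_subZ.
  have [->|sN0] := eqVneq s 0; first by right.
  have s_gt0 : 0 < s by rewrite lt_neqAle eq_sym sN0.
  move=> H; left; rewrite -(ler_pM2l s_gt0); move: H; nra.
have dd := dot_ge0 d; have cc := dot_gt0 xp0; rewrite -/c in cc.
have cd : dot c d <= 0.
  rewrite leNgt; apply/negP => cd.
  have [dc|dc] := leP (dot d d) (dot c d).
    have [|] := ineq 1 ler01 (lexx _); last by move/eqP; rewrite oner_eq0.
    rewrite mul1r; lra.
  have d0 : 0 < dot d d by lra.
  have q0 : 0 <= dot c d / dot d d by rewrite divr_ge0 // ltW.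
  have q1 : dot c d / dot d d <= 1 by rewrite ler_pdivrMr // mul1r ltW.
  have [|/eqP] := ineq _ q0 q1; first by rewrite divfK ?gt_eqF //; lra.
  by rewrite mulf_eq0 invr_eq0 !gt_eqF.
have Ep : dot c p = dot c p0 + dot c d by rewrite -dotDr /d addrC subrK.
have Ex : dot c x = dot c p0 + dot c c by rewrite -dotDr; congr (dot c _); rewrite /c addrC subrK.
lra.
Qed.

End Separation.

(** * Support functions of signed Minkowski sums *)

Section SupportFunctions.
Variables (R : realType) (n : nat).
Local Notation V := 'rV[R]_n.
Implicit Types (u v w c x : V) (K L : set V) (S : {set pm_index n}) (A B : signed_set n).

Definition has_support K c (h : R) :=
  (forall x, K x -> dot c x <= h) /\ (exists2 x, K x & dot c x = h).

Lemma has_support_add K L c h h' :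
  has_support K c h -> has_support L c h' -> has_support (mink_add K L) c (h + h').
Proof.
move=> [Kh [x Kx xh]] [Lh [z Lz zh]]; split.
  by move=> _ [p Kp [q Lq <-]]; rewrite dotDr lerD ?Kh ?Lh.
by exists (x + z); [exists x => //; exists z | rewrite dotDr xh zh].
Qed.

(** The maximizers of a sum are sums of maximizers, so a summand can be removed. *)
Lemma has_support_subtract K L c h h' :
  has_support L c h' -> has_support (mink_add K L) c h -> has_support K c (h - h').
Proof.
move=> [Lh [z Lz zh]] [KLh [_ [p Kp [q Lq <-]] pqh]].
have le_h x : K x -> dot c x <= h - h'.
  move=> Kx; rewrite lerBrDr -zh -dotDr; apply: KLh.
  by exists x => //; exists z.
split => //; exists p => //; apply/eqP; rewrite eq_le le_h //=.
by rewrite lerBlDr -pqh dotDr lerD2l Lh.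
Qed.

Lemma has_support_dilate K c h t : 0 <= t -> has_support K c h -> has_support (dilate t K) c
  (t * h).
Proof.
move=> t0 [Kh [x Kx xh]]; split.
  by move=> _ [p Kp <-]; rewrite dotZr ler_wpM2l ?Kh.
by exists (t *: x); [exists x | rewrite dotZr xh].
Qed.

Lemma has_support_sum (m : nat) (P : pred 'I_m) (K : 'I_m -> set V) c (h : 'I_m -> R) :
  (forall i, P i -> has_support (K i) c (h i)) ->
  has_support (\big[@mink_add R n/[set 0]]_(i < m | P i) K i) c (\sum_(i < m | P i) h i).
Proof.
move=> Kh; apply: (big_ind2 (fun K h => has_support K c h)) => //.
- by split=> [x ->|]; [rewrite dot0r | exists 0; rewrite // dot0r].
- by move=> *; apply: has_support_add.
Qed.

Lemma signed_mink_sum_support (m : nat) (P : set V) (y : 'I_m -> R)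
    (S : 'I_m -> {set pm_index n}) c (h : 'I_m -> R) :
  (forall i, has_support (simplex0 (S i)) c (h i)) ->
  is_signed_mink_sum P y S -> has_support P c (\sum_i y i * h i).
Proof.
move=> Sh PS; rewrite (bigID (fun i => 0 <= y i)) /=.
under [X in _ + X]eq_bigl do rewrite -ltNge.
rewrite -[X in _ + X]opprK -sumrN; under [X in _ - X]eq_bigr do rewrite -mulNr.
apply: (@has_support_subtract _ (\big[@mink_add R n/[set 0]]_(i < m | y i < 0) dilate
  (- y i) (simplex0 (S i)))).
  by apply: has_support_sum => i yi; apply: has_support_dilate; rewrite ?oppr_ge0 ?ltW.
rewrite PS; apply: has_support_sum => i yi; exact: has_support_dilate.
Qed.

Definition basis_coef c (k : pm_index n) : R :=
  match k with inl i => c 0 i | inr i => - c 0 i end.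

Lemma dot_basis_vec c k : dot c (basis_vec R k) = basis_coef c k.
Proof.
have E i : dot c (delta_mx 0 i) = c 0 i.
  rewrite /dot (bigD1 i) //= big1 => [|j ji]; first by rewrite mxE !eqxx mulr1 addr0.
  by rewrite mxE (negPf ji) andbF mulr0.
by case: k => i /=; rewrite ?dotNr E.
Qed.

Definition simplex_support S c : R := \big[Num.max/0]_(k in S) basis_coef c k.

Lemma simplex_support_eq S c h :
  0 <= h -> (forall k, k \in S -> basis_coef c k <= h) ->
  (h = 0 \/ exists2 k, k \in S & basis_coef c k = h) -> simplex_support S c = h.
Proof.
move=> h0 le_h at_h; apply/eqP; rewrite eq_le; apply/andP; split.
  exact: bigmax_le.
case: at_h => [->|[k kS <-]]; first exact: bigmax_ge_id.
by rewrite /simplex_support (bigD1 k) //= le_max lexx.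
Qed.

Lemma simplex_support_ge0 S c : 0 <= simplex_support S c.
Proof. exact: bigmax_ge_id. Qed.

Lemma simplex_support_ge S c k : k \in S -> basis_coef c k <= simplex_support S c.
Proof. by move=> kS; rewrite /simplex_support (bigD1 k) //= le_max lexx. Qed.

Lemma simplex_support_attained S c :
  simplex_support S c = 0 \/ exists2 k, k \in S & basis_coef c k = simplex_support S c.
Proof.
rewrite /simplex_support.
apply: (big_rec (fun h => h = 0 \/ exists2 k, k \in S & basis_coef c k = h)); first by left.
move=> k h kS IH; case: (leP (basis_coef c k) h) => // _.
by right; exists k.
Qed.

Lemma has_support_simplex0 S c : has_support (simplex0 S) c (simplex_support S c).
Proof.
split=> [x|].
  have := @smallest_sub _ (@convex_set R V) (0 |` [set basis_vec R k | k in [set` S]])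
    [set z | dot c z <= simplex_support S c].
  move=> /(_ _ _ x); apply.
    apply/convex_setE => u v t t0 t1 /= cu cv; rewrite dotDr !dotZr.
    have := ler_wpM2l t0 cu; have t1' : 0 <= 1 - t by rewrite subr_ge0.
    have := ler_wpM2l t1' cv; lra.
  move=> _ [->|[k /= kS <-]] /=; first by rewrite dot0r simplex_support_ge0.
  by rewrite dot_basis_vec simplex_support_ge.
case: (simplex_support_attained S c) => [->|[k kS <-]].
  by exists 0; [apply: sub_gen_smallest; left | rewrite dot0r].
exists (basis_vec R k); last exact: dot_basis_vec.
by apply: sub_gen_smallest; right; exists k.
Qed.

Definition contains_elt A (k : pm_index n) : bool :=
  match k with inl i => A i == Some true | inr i => A i == Some false end.

Definition meets_simplex S A : R := [exists k in S, contains_elt A k]%:R.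

Definition signed_vec A : V := \row_i sgn_val R (A i).

Lemma dot_signed_vec A x : dot (signed_vec A) x = spair A x.
Proof. by apply: eq_bigr => i _; rewrite mxE. Qed.

Lemma meets_simplex_1 S A k : k \in S -> contains_elt A k -> meets_simplex S A = 1.
Proof. by move=> kS kA; rewrite /meets_simplex; case: existsP => // -[]; exists k;
  rewrite kS. Qed.

Lemma meets_simplex_0 S A : (forall k, k \in S -> ~~ contains_elt A k) -> meets_simplex S A = 0.
Proof.
move=> kA; rewrite /meets_simplex; case: existsP => // -[k /andP[/kA]].
by move=> /negPf ->.
Qed.

Lemma meets_simplexP S A :
  (exists2 k, k \in S & contains_elt A k) \/ (forall k, k \in S -> ~~ contains_elt A k).
Proof.
case: (boolP [exists k in S, contains_elt A k]) => [/existsP[k /andP[]]|]; first by left;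
  exists k.
rewrite negb_exists => /forallP SA; right => k kS.
by have := SA k; rewrite kS.
Qed.


(** On a chain of signed sets the support function of a simplex is additive. *)
Lemma simplex_support_nested S A B : (forall i, A i = None \/ A i = B i) ->
  simplex_support S (signed_vec A + signed_vec B) = meets_simplex S A + meets_simplex S B.
Proof.
move=> AB.
have hAB k : contains_elt A k -> contains_elt B k.
  by case: k => i /= /eqP Ai; case: (AB i); rewrite Ai => // <-.
have c2 k : contains_elt A k -> basis_coef (signed_vec A + signed_vec B) k = 1 + 1.
  move=> kA; have := hAB k kA; case: k kA => i /= /eqP Ai /eqP Bi.
    by rewrite !mxE Ai Bi.
  by rewrite !mxE Ai Bi /= opprD opprK.
have c1 k : ~~ contains_elt A k -> contains_elt B k -> basis_coef (signed_vec A +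
  signed_vec B) k = 1.
  case: k => i /= Ai /eqP Bi; rewrite !mxE; case: (AB i) => E; rewrite E in Ai *.
  - by rewrite Bi /= add0r.
  - by rewrite Bi in Ai.
  - by rewrite Bi /= add0r opprK.
  - by rewrite Bi in Ai.
have c0 k : ~~ contains_elt B k -> basis_coef (signed_vec A + signed_vec B) k <= 0.
  case: k => i /= Bi; rewrite !mxE; case: (AB i) => ->; case: (B i) Bi => [[]|] //= _;
  rewrite ?addr0 ?add0r; lra.
case: (meets_simplexP S A) => [[k kS kA]|SA].
  rewrite (meets_simplex_1 kS kA) (meets_simplex_1 kS (hAB _ kA)).
  apply: simplex_support_eq; [lra| |by right; exists k; rewrite ?c2].
  move=> l lS; have [lA|lA] := boolP (contains_elt A l); first by rewrite c2.
  have [lB|lB] := boolP (contains_elt B l); first by rewrite c1 //; lra.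
  by have := c0 l lB; lra.
rewrite (meets_simplex_0 SA) add0r; case: (meets_simplexP S B) => [[k kS kB]|SB].
  rewrite (meets_simplex_1 kS kB); apply: simplex_support_eq; [lra| |by right; exists k;
    rewrite ?c1 ?SA].
  move=> l lS; have [lB|lB] := boolP (contains_elt B l); first by rewrite c1 ?SA.
  by have := c0 l lB; lra.
rewrite (meets_simplex_0 SB); apply: simplex_support_eq; [lra| |by left].
by move=> l lS; apply/c0/SB.
Qed.

(** Induction on the number of nonzero coordinates: subtract the sign vector of [c]
    times the smallest nonzero absolute value of its coordinates.  This lowers every
    positive [basis_coef c k] by that value and keeps the others nonpositive. *)
Lemma layer_cake c : exists l : seq (R * signed_set n),
  [/\ forall p, p \in l -> 0 <= p.1,
      forall x, dot c x = \sum_(p <- l) p.1 * spair p.2 x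
    & forall S, simplex_support S c = \sum_(p <- l) p.1 * meets_simplex S p.2].
Proof.
move: {2}#|_| (leqnn #|[set i | c 0 i != 0]%SET|) => N.
elim: N c => [|N IH] c.
  rewrite leqn0 cards_eq0 => /eqP c0.
  have {}c0 : c = 0.
    apply/rowP => i; rewrite mxE; apply/eqP/negPn/negP => ci.
    by have := finset.in_set0 i; rewrite -c0 inE ci.
  exists [::]; split => // [x|S]; rewrite big_nil.
    by rewrite c0 dotC dot0r.
  apply: simplex_support_eq => //; last by left.
  by move=> [] k _ /=; rewrite c0 mxE ?oppr0.
move=> cN; have [[i0 ci0]|c0] := pselect (exists i, c 0 i != 0); last first.
  apply: IH; rewrite (_ : [set i | c 0 i != 0]%SET = finset.set0) ?cards0 //.
  by apply/finset.setP => i; rewrite !inE; apply/negbTE/negP => ci; apply: c0; exists i.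
pose i1 := [arg min_(i < i0 | c 0 i != 0) `|c 0 i|]%O.
have [ci1 min_i1] : c 0 i1 != 0 /\ forall i, c 0 i != 0 -> `|c 0 i1| <= `|c 0 i|.
  by rewrite /i1; case: arg_minP.
pose lam := `|c 0 i1|; have lam0 : 0 < lam by rewrite normr_gt0.
pose A : signed_set n := [ffun i =>
  if 0 < c 0 i then Some true else if c 0 i < 0 then Some false else None].
pose c' := c - lam *: signed_vec A.
have c'E i : c' 0 i = c 0 i - lam * sgn_val R (A i) by rewrite !mxE.
(* lam is the smallest nonzero absolute value, whence the gap around 0. *)
have tri i : [\/ c 0 i = 0 /\ A i = None, lam <= c 0 i /\ A i = Some true
    | c 0 i <= - lam /\ A i = Some false].
  rewrite ffunE; case: (ltrgtP 0 (c 0 i)) => ci.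
  - constructor 2; split => //; have := min_i1 i; rewrite gt_eqF // => /(_ isT).
    by rewrite [X in _ <= X]gtr0_norm.
  - constructor 3; split => //; have := min_i1 i; rewrite lt_eqF // => /(_ isT).
    by rewrite [X in _ <= X]ltr0_norm // lerNr.
  - by constructor 1.
have [l [l0 lx lS]] : exists l : seq (R * signed_set n),
  [/\ forall p, p \in l -> 0 <= p.1,
      forall x, dot c' x = \sum_(p <- l) p.1 * spair p.2 x
    & forall S, simplex_support S c' = \sum_(p <- l) p.1 * meets_simplex S p.2].
  apply: IH; rewrite -ltnS; apply: leq_trans cN; apply: proper_card.
  apply/fintype.properP; split; last first.
    exists i1; rewrite !inE // c'E negbK /lam.
    case: (tri i1) => -[ci Ai]; rewrite Ai /=.
    - by rewrite ci eqxx in ci1.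
    - by rewrite mulr1 gtr0_norm ?subrr //; lra.
    - by rewrite mulrN1 opprK ltr0_norm ?subrr //; lra.
  apply/fintype.subsetP => i; rewrite !inE; apply: contraNN => /eqP ci.
  rewrite c'E; case: (tri i) => -[ci' Ai]; rewrite Ai /= ?ci ?mulr0 ?subr0 //.
  - by exfalso; lra.
  - by exfalso; lra.
exists ((lam, A) :: l); split => [p|x|S].
- by rewrite in_cons => /predU1P[->|/l0 //]; apply: ltW.
- rewrite big_cons -lx -dot_signed_vec /c' dotDl dotNl dotZl /=; ring.
rewrite big_cons -lS /=.
have coef_hit k : contains_elt A k -> lam <= basis_coef c k /\ basis_coef c' k =
  basis_coef c k - lam.
  case: k => i /= /eqP Ai; rewrite c'E Ai; case: (tri i) => -[ci Ai'];
    rewrite Ai' // in Ai *; split; rewrite /=; lra.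
have coef_miss k : ~~ contains_elt A k -> basis_coef c k <= 0 /\ basis_coef c' k <= 0.
  by case: k => i /= Ai; rewrite c'E; case: (tri i) => -[ci Ai'];
    rewrite Ai' // in Ai *; split; rewrite /=; lra.
have s0 := simplex_support_ge0 S c'.
case: (meets_simplexP S A) => [[k kS kA]|SA]; last first.
  rewrite (meets_simplex_0 SA) mulr0 add0r.
  have -> : simplex_support S c' = 0.
    apply: simplex_support_eq => //; last by left.
    by move=> k kS; have [] := coef_miss k (SA k kS).
  apply: simplex_support_eq => //; last by left.
  by move=> k kS; have [] := coef_miss k (SA k kS).
rewrite (meets_simplex_1 kS kA) mulr1; apply: simplex_support_eq; first lra.
  move=> k' k'S; have [/coef_hit[_]|/coef_miss[]] := boolP (contains_elt A k'); last lra.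
  by have := simplex_support_ge c' k'S; lra.
right; case: (simplex_support_attained S c') => [s'0|[k' k'S s'E]].
  exists k => //; have [lk E] := coef_hit k kA.
  by have := simplex_support_ge c' kS; rewrite s'0; lra.
have [k'A|k'A] := boolP (contains_elt A k').
  by exists k' => //; have [_] := coef_hit k' k'A; rewrite -s'E; lra.
exists k => //; have [lk E] := coef_hit k kA; have [_] := coef_miss k' k'A.
by have := simplex_support_ge c' kS; lra.
Qed.

Section SignedSum.
Variables (m : nat) (S : 'I_m -> {set pm_index n}) (y : 'I_m -> R) (P : set V).
Hypotheses (Ppoly : is_polytope P) (PS : is_signed_mink_sum P y S).

Definition signed_rank A : R := \sum_i y i * meets_simplex (S i) A.

Lemma signed_sum_support c : has_support P c (\sum_i y i * simplex_support (S i) c).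
Proof. by apply: signed_mink_sum_support PS => i; apply: has_support_simplex0. Qed.

Lemma meets_simplex_sempty S' : meets_simplex S' (sempty n) = 0.
Proof. by apply: meets_simplex_0 => -[] i _ /=; rewrite ffunE. Qed.

Lemma signed_rank_sempty : signed_rank (sempty n) = 0.
Proof. by rewrite /signed_rank big1 // => i _; rewrite meets_simplex_sempty mulr0. Qed.

Lemma spair_le_signed_rank x A : P x -> spair A x <= signed_rank A.
Proof.
have [le_P _] := signed_sum_support (signed_vec (sempty n) + signed_vec A).
move=> /le_P; rewrite dotDl !dot_signed_vec spair_sempty add0r => /le_trans; apply.
rewrite le_eqVlt; apply/orP; left; apply/eqP/eq_bigr => i _.
rewrite simplex_support_nested ?meets_simplex_sempty ?add0r // => j.
by left; rewrite ffunE.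
Qed.

(** The vectors of [A] and [B] have the same sum as those of the nested pair
    [meets A B], [joins A B], on which the support function of [P] is additive. *)
Lemma signed_rank_bisubmodular : bisubmodular signed_rank.
Proof.
move=> A B.
have [_ [p Pp pE]] := signed_sum_support (signed_vec A + signed_vec B).
have E : signed_vec A + signed_vec B = signed_vec (meets A B) + signed_vec (joins A B).
  by apply/rowP => i; rewrite !mxE !ffunE sgn_valD.
have -> : signed_rank (meets A B) + signed_rank (joins A B) = spair A p + spair B p.
  rewrite -!dot_signed_vec -dotDl pE /signed_rank -big_split; apply: eq_bigr => i _ /=.
  rewrite E simplex_support_nested ?mulrDr // => j; rewrite !ffunE.
  by move: (A j) (B j) => [[]|] [[]|]; rewrite /smeet /=;
    [right | left | left | left | right | left | left | left | left].
by apply: lerD; apply: spair_le_signed_rank.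
Qed.

(** A point outside [P] is separated by some [c], which decomposes as in [layer_cake];
    so the point violates one of the inequalities of the signed sets. *)
Lemma signed_sum_polytope : P = bisub_polytope signed_rank.
Proof.
apply/seteqP; split => x Px; first by move=> A; apply: spair_le_signed_rank.
apply: contrapT => /(separation Ppoly)[c sep].
have [_ [p Pp pE]] := signed_sum_support c.
have [l [l0 lx lS]] := layer_cake c.
have := sep p Pp; rewrite pE ltNge => /negP; apply.
rewrite lx.
have -> : \sum_i y i * simplex_support (S i) c = \sum_(q <- l) q.1 * signed_rank q.2.
  under eq_bigr do rewrite lS mulr_sumr.
  rewrite exchange_big /=; apply: eq_bigr => q _; rewrite mulr_sumr.
  by apply: eq_bigr => i _; rewrite mulrCA.
rewrite !big_seq; apply: ler_sum => q ql; apply: ler_wpM2l; first exact: l0.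
exact: Px.
Qed.

Lemma signed_rank_signing tau (A : {set 'I_n}) :
  signed_rank (signing tau A)
    = \sum_i y i * (A :&: [set j | signed_elt tau j \in S i]%SET != finset.set0)%:R.
Proof.
apply: eq_bigr => i _; congr (_ * _%:R); congr (nat_of_bool _).
apply/existsP/set0Pn => [[k /andP[kS kA]]|[j]].
  have [j [kj jA]] : exists j, k = signed_elt tau j /\ j \in A.
    case: k kA {kS} => j /=; rewrite ffunE; case: ifP => // jA /eqP[tj];
    by exists j; rewrite /signed_elt tj.
  by exists j; rewrite !inE jA -kj.
rewrite !inE => /andP[jA jS]; exists (signed_elt tau j); rewrite jS /=.
by rewrite /signed_elt; case tj: (tau j); rewrite /= ffunE jA tj.
Qed.

End SignedSum.
End SupportFunctions.

Theorem corollary4p13 (R : realType) (n m : nat)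
    (n_ge1 : (1 <= n)%N) (m_ge1 : (1 <= m)%N)
    (S : 'I_m -> {set pm_index n}) (S_adm : forall i, S i \in AdS n)
    (y : 'I_m -> R) (P : set 'rV[R]_n)
    (P_typeB : typeB_gen_permutohedron P)
    (P_sum : is_signed_mink_sum P y S) :
  vol P = (\sum_(T in AdS_max n) \sum_(a in draconian S T)
             \prod_(i < m) (y i ^+ a i / (a i)`!%:R))%:E.
Proof.
have [Ppoly _] := P_typeB.
rewrite (signed_sum_polytope Ppoly P_sum) vol_bisubmodular.
- rewrite sum_AdS_max //; congr (_%:E); apply: eq_bigr => tau _.
  rewrite -hall_vol_draconian; apply: eq_hall_vol => A; exact: signed_rank_signing.
- exact: signed_rank_bisubmodular P_sum.
- exact: signed_rank_sempty.
Qed.
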